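(* Let $0<a<b<\infty$, let $\pi_1$ be a probability density on $\mathbb{R}_+$ (with respect to Lebesgue measure) with compact support in $\mathbb{R}_+$, and let $\pi_t(x)=t^{-1}\pi_1(t^{-1}x)$ for $t\in[a,b]$. Suppose moreover that $\pi_1$ has a $k$-th derivative bounded on $\mathbb{R}_+$, where $k\ge1$ is an integer. Let $C>(b-a)^{-1/2}$ and $\alpha\ge1$. If $k>\alpha$, then there exists $C^*>0$ such that, as $n\to\infty$, $$\inf_{\hat f\in\mathcal{S}_n}\ \sup_{f\in\tilde{\mathcal{C}}(\alpha,C)\cap\mathbb{H}_1}\pi_f^{\otimes n}\|\hat f-f\|_{\mathbb{H}}^2\ \ge\ C^*\,n^{-2\alpha/(k-\alpha)}(1+o(1)).$$
   Context: $\mathbb{H}=L^2([a,b])$; $\mathbb{H}_1=\{f\in\mathbb{H}:f\ge0,\ \int_a^bf(t)\,dt=1\}$. For $f\in\mathbb{H}_1$, $\pi_f(x)=\int_a^bf(t)\pi_t(x)\,dt$ is the mixture density and $\pi_f^{\otimes n}$ denotes the joint distribution of $n$ i.i.d. observations with density $\pi_f$; $\pi_f^{\otimes n}\|\hat f-f\|^2_{\mathbb{H}}$ is the expectation of $\|\hat f(X_1,\dots,X_n)-f\|_{\mathbb{H}}^2$ under it. $\mathcal{S}_n$ is the set of all Borel functions from $\mathbb{R}^n$ to $\mathbb{H}$. For $r\in\mathbb{N}^*$, $h\in\mathbb{R}$ and $f:[a,b]\to\mathbb{R}$, let $\Delta_h^r(f,x)=\sum_{i=0}^r\binom{r}{i}(-1)^if(x+(i-r/2)h)$,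 with the convention $\Delta_h^r(f,x)=0$ if $x+rh/2\notin[a,b]$ or $x-rh/2\notin[a,b]$. Let $\varphi(x)=\sqrt{(x-a)(b-x)}$ and $\omega_\varphi^r(f,t)_2=\sup_{0<h\le t}\|x\mapsto\Delta^r_{h\varphi(x)}(f,x)\|_{L^2([a,b])}$. With $r=[\alpha]+1$ ($[\alpha]$ the integer part of $\alpha$), $$\tilde{\mathcal{C}}(\alpha,C)=\{f\in\mathbb{H}:\|f\|_{\mathbb{H}}\le C\text{ and }\omega_\varphi^r(f,t)_2\le Ct^\alpha\text{ for all }t>0\}.$$ *)

(* Defs.v *)
From HB Require Import structures.
From mathcomp Require Import all_boot all_order all_algebra.
From mathcomp Require Import all_classical all_reals all_analysis.
From mathcomp Require Import measurable_realfun.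

Set Implicit Arguments.
Unset Strict Implicit.
Unset Printing Implicit Defensive.

Import Order.TTheory GRing.Theory Num.Theory.
Import numFieldNormedType.Exports.

Local Open Scope classical_set_scope.
Local Open Scope ring_scope.

Section L2.
Context {R : realType}.
Variables a b : R.

Definition lebesgue_ab : {measure set (measurableTypeR R) -> \bar R} :=
  mrestr (@lebesgue_measure R) (measurable_itv `[a, b]).

Definition L2norm (f : R -> R) : \bar R := 'N[lebesgue_ab]_2%:E[EFin \o f].

(* L^2([a, b]) is represented by square-integrable Borel functions on R, whose
   values outside [a, b] are irrelevant and which are at distance 0 from each
   other when they agree almost everywhere on [a, b].  Nothing below depends on
   the choice of a representative; for the modulus of smoothness this is because
   x |-> x + c * phi x pulls Lebesgue-null sets back to null sets. *)
Definition L2 : Type := LfunType lebesgue_ab (lee1n 2 : (1 <= 2%:E :> \bar R)%E).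

Definition L2dist (f g : L2) : \bar R := L2norm (fun t => f t - g t).

Definition L2open (U : set L2) : Prop := forall f, U f ->
  exists2 e : R, 0 < e & forall g, (L2dist g f < e%:E)%E -> U g.

Definition mixing_densities : set L2 :=
  [set f | {ae lebesgue_ab, forall t, 0 <= f t} /\
           (\int[lebesgue_measure]_(t in `[a, b]) (f t)%:E = 1)%E].

Definition Delta (r : nat) (h : R) (f : R -> R) (x : R) : R :=
  if (x + r%:R * h / 2 \in `[a, b]) && (x - r%:R * h / 2 \in `[a, b]) then
    \sum_(i < r.+1) 'C(r, i)%:R * (-1) ^+ i * f (x + (i%:R - r%:R / 2) * h)
  else 0.

Definition phi (x : R) : R := Num.sqrt ((x - a) * (b - x)).

Definition omega_phi (r : nat) (f : R -> R) (t : R) : \bar R :=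
  ereal_sup [set L2norm (fun x => Delta r (h * phi x) f x) |
             h in [set h : R | 0 < h <= t]].

Definition smooth_class (alpha C : R) : set L2 :=
  let r := (Num.truncn alpha).+1 in
  [set f | (L2norm f <= C%:E)%E /\
    forall t : R, 0 < t -> (omega_phi r f t <= (C * t `^ alpha)%:E)%E].

End L2.

Arguments mixing_densities {R} a b.
Arguments smooth_class {R} a b alpha C.

Section density.
Context {R : realType}.

Definition is_density (p : R -> R) : Prop :=
  [/\ measurable_fun [set: R] p, (forall x, 0 <= p x) &
      (\int[lebesgue_measure]_x (p x)%:E = 1)%E].

Section law_of_density.
Variables (p : R -> R) (p_density : is_density p).

Definition law_of (_ : is_density p) (A : set (measurableTypeR R)) : \bar R :=
  (\int[lebesgue_measure]_(x in A) (p x)%:E)%E.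

Local Notation law := (law_of p_density).

Let law0 : law set0 = 0%E.
Proof. by rewrite /law_of integral_set0. Qed.

Let law_ge0 A : (0 <= law A)%E.
Proof.
by have [_ p0 _] := p_density; apply: integral_ge0 => x _; rewrite lee_fin.
Qed.

Let law_sigma_additive : semi_sigma_additive law.
Proof.
have [mp p0 _] := p_density; move=> A mA tA mUA; rewrite /law_of.
rewrite ge0_integral_bigcup//; last 2 first.
- by apply/measurable_EFinP; exact: measurable_funTS.
- by move=> x _; rewrite lee_fin.
apply: is_cvg_ereal_nneg_natsum_cond => n _ _.
by apply: integral_ge0 => x _; rewrite lee_fin.
Qed.

HB.instance Definition _ := isMeasure.Build _ _ _ law
  law0 law_ge0 law_sigma_additive.

Let law_setT : law [set: _] = 1%E.
Proof. by have [] := p_density. Qed.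

HB.instance Definition _ := Measure_isProbability.Build _ _ R law law_setT.

End law_of_density.

(* The value at functions that are not probability densities is arbitrary; it is
   never reached by the mixtures considered below, cf. mixture_is_density. *)
Definition density_law (p : R -> R) : probability (measurableTypeR R) R :=
  match pselect (is_density p) with
  | left p_density => law_of p_density
  | right _ => dirac (0 : measurableTypeR R)
  end.

Definition tuple_cons (n : nat)
    (xt : measurableTypeR R * n.-tuple (measurableTypeR R)) :
  n.+1.-tuple (measurableTypeR R) := [the n.+1.-tuple _ of xt.1 :: xt.2].

Lemma measurable_tuple_cons n : measurable_fun setT (@tuple_cons n).
Proof. by apply: measurable_cons. Qed.

HB.instance Definition _ n := isMeasurableFun.Build _ _ _ _ (@tuple_cons n)
  (@measurable_tuple_cons n).

(* the n-fold product measure of P, cf. iid_law_box *)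
Fixpoint iid_law (P : probability (measurableTypeR R) R) (n : nat) :
    probability (n.-tuple (measurableTypeR R)) R :=
  match n return probability (n.-tuple (measurableTypeR R)) R with
  | 0%N => dirac ([tuple] : 0.-tuple (measurableTypeR R))
  | m.+1 => distribution (P \x iid_law P m)%E (@tuple_cons m)
  end.

Lemma iid_law_box (P : probability (measurableTypeR R) R) n
    (A : 'I_n -> set (measurableTypeR R)) : (forall i, measurable (A i)) ->
  iid_law P n [set t | forall i, A i (tnth t i)] = (\prod_(i < n) P (A i))%E.
Proof.
elim: n A => [|n IH] A mA /=.
  by rewrite big_ord0 diracE mem_set// => -[].
rewrite big_ord_recl -(IH (fun i => A (lift ord0 i)))// /distribution /pushforward.
have mB : measurable [set t : n.-tuple (measurableTypeR R) |
    forall i, A (lift ord0 i) (tnth t i)].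
  rewrite (_ : [set _ | _] =
      \bigcap_(i in [set: 'I_n]) ((@tnth _ _ ^~ i) @^-1` A (lift ord0 i))).
    apply: fin_bigcap_measurable => // i _; rewrite -[X in measurable X]setTI.
    by apply: measurable_tnth.
  by apply/seteqP; split=> t /= Ht i; [move=> _|]; exact: Ht.
rewrite -product_measure1E//; congr (_ _).
apply/seteqP; split=> -[x t] /=.
  move=> h; split; first by have := h ord0.
  by move=> i; have := h (lift ord0 i); rewrite tnthS.
move=> [hx ht] i; case: (unliftP ord0 i) => [j ->|->] //.
by rewrite tnthS; exact: ht.
Qed.

End density.

Section minimax.
Context {R : realType}.
Variables (a b : R) (pi1 : R -> R).

Definition scale_kernel (t x : R) : R := t^-1 * pi1 (t^-1 * x).

Definition mixture (f : L2 a b) (x : R) : R :=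
  \int[lebesgue_measure]_(t in `[a, b]) (f t * scale_kernel t x).

(* Borel maps from R^n to L^2([a, b]) *)
Definition estimators (n : nat) :
    set (n.-tuple (measurableTypeR R) -> L2 a b) :=
  [set fhat | forall U, L2open U -> measurable (fhat @^-1` U)].

Definition risk (n : nat) (fhat : n.-tuple (measurableTypeR R) -> L2 a b)
    (f : L2 a b) : \bar R :=
  (\int[iid_law (density_law (mixture f)) n]_X (L2dist (fhat X) f ^+ 2))%E.

Definition minimax_risk (F : set (L2 a b)) (n : nat) : \bar R :=
  ereal_inf [set ereal_sup [set risk fhat f | f in F] | fhat in @estimators n].

End minimax.

Section mixture_density.
Context {R : realType}.
Local Notation mu := (@lebesgue_measure R).

Let measurable_mull (c : R) :
  measurable_fun setT (fun x : measurableTypeR R => c * x : measurableTypeR R).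
Proof. exact: measurable_funM. Qed.

Let scaled_lebesgue (c : R) (c0 : 0 < c) : {measure set (measurableTypeR R) -> \bar R} :=
  mscale (NngNum (ltW c0))
    (measure_function_pushforward__canonical__measure_function_Measure mu
      (measurable_mull c)).

Let scaled_lebesgueE (c : R) (c0 : 0 < c) (A : set R) : measurable A ->
  scaled_lebesgue c0 A = mu A.
Proof.
move=> mA.
apply/esym/(@lebesgue_measure_unique R (scaled_lebesgue c0)) => //= _ [[u v]] _ <-.
rewrite /scaled_lebesgue/= /mscale/= /pushforward.
have -> : (fun x : measurableTypeR R => c * x) @^-1` `]u, v]%classic = `]u / c, v / c]%classic.
  by apply/seteqP; split=> x /=; rewrite !in_itv/= ler_pdivlMr// ltr_pdivrMr// mulrC.
rewrite !lebesgue_measure_itv/= !lte_fin ltr_pM2r ?invr_gt0//.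
case: ifPn => // _; last by rewrite mule0.
by rewrite -!EFinD -EFinM -mulrBl mulrCA divff ?mulr1// gt_eqF.
Qed.

Lemma integral_scale (c : R) (p : R -> R) : 0 < c -> measurable_fun setT p ->
  (forall x, 0 <= p x) ->
  (\int[mu]_x (c * p (c * x))%:E = \int[mu]_x (p x)%:E)%E.
Proof.
move=> c0 mp p0.
transitivity (\int[scaled_lebesgue c0]_x (p x)%:E)%E; last first.
  by apply: eq_measure_integral => A mA _; exact: scaled_lebesgueE.
have mp' : measurable_fun setT (EFin \o p) by exact/measurable_EFinP.
rewrite ge0_integral_mscale//=; last by move=> x _; rewrite lee_fin.
rewrite ge0_integral_pushforward//=; last by move=> x _; rewrite lee_fin.
rewrite preimage_setT -ge0_integralZl//=.
- by apply: (@measurableT_comp _ _ _ _ _ _ (EFin \o p)).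
- by move=> x _; rewrite lee_fin.
- by rewrite lee_fin ltW.
Qed.

Lemma mixture_is_density (a b : R) (pi1 : R -> R) (f : L2 a b) :
  0 < a -> is_density pi1 -> mixing_densities a b f -> is_density (mixture pi1 f).
Proof.
move=> a0 [mp p0 p1] [f0 f1].
have mf : measurable_fun setT (f : R -> R) by exact: (measurable_funPT f).
pose g := ((f : R -> R)^\+)%R \_ `[a, b].
have mg : measurable_fun setT g.
  apply/(measurable_restrictT _ (measurable_itv _)).
  by apply: measurable_funTS; exact: (measurable_funrpos mf).
have g0 t : 0 <= g t.
  by rewrite /g patchE; case: ifP => // _; rewrite le_max lexx orbT.
have fg : {ae mu, forall t, `[a, b]%classic t -> f t = g t}.
  have [N [mN N0 sN]] := f0.
  exists (N `&` `[a, b]); split; [exact: measurableI | exact: N0 |].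
  move=> t /= /not_implyP[tab ftg]; split => //; apply: sN => /= ft0; apply: ftg.
  by rewrite /g patchE mem_set//; apply/esym/max_idPl.
pose F (z : measurableTypeR R * measurableTypeR R) : \bar R :=
  (g z.1 * (z.1 `^ (-1) * pi1 (z.1 `^ (-1) * z.2)))%:E.
have mF : measurable_fun setT F.
  apply/measurable_EFinP; apply: measurable_funM.
    exact: measurableT_comp.
  have m1 : measurable_fun setT (fun z : measurableTypeR R * measurableTypeR R => z.1 `^ (-1)).
    by apply: (measurableT_comp (measurable_powR _)).
  apply: measurable_funM => //.
  by apply: measurableT_comp => //; exact: measurable_funM.
have F0 z : (0 <= F z)%E by rewrite lee_fin !mulr_ge0// powR_ge0.
pose G x := (\int[mu]_t F (t, x))%E.
have G0 x : (0 <= G x)%E by apply: integral_ge0.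
have mG : measurable_fun setT G.
  exact: (measurable_fun_fubini_tonelli_G F).
have mixE x : mixture pi1 f x = fine (G x).
  rewrite /mixture /Rintegral; congr fine.
  rewrite /G (_ : (fun t => F (t, x)) = (fun t => F (t, x)) \_ `[a, b]); last first.
    apply/funext => t; rewrite patchE; case: ifPn => // tab.
    by rewrite /F/= /g patchE (negbTE tab) mul0r.
  rewrite -integral_mkcond.
  apply: ae_eq_integral => //.
  - apply/measurable_EFinP; apply: measurable_funM; first exact: measurable_funTS.
    apply: (@eq_measurable_fun _ _ _ _ _
        (fun t : R => t `^ (-1) * pi1 (t `^ (-1) * x))).
      move=> t; rewrite inE/= in_itv/= => /andP[at_ _].
      by rewrite /scale_kernel powR_inv1// ltW// (lt_le_trans a0).
    apply: measurable_funTS.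
    by apply: measurable_funM => //; apply: measurableT_comp => //;
      exact: measurable_funM.
  - by apply: measurable_funTS; exact: (@measurableT_comp _ _ _ _ _ _ F).
  apply: (@filterS _ _ (ae_filter_ringOfSetsType mu) _ _ _ fg) => t /= ftg tab; have := tab; rewrite in_itv/= => /andP[at_ _].
  by rewrite /F/= -ftg// /scale_kernel powR_inv1// ltW// (lt_le_trans a0).
have intG : (\int[mu]_x G x = 1)%E.
  rewrite /G -(fubini_tonelli F)//.
  rewrite -[RHS]f1 [RHS]integral_mkcond.
  transitivity (\int[mu]_t (g t)%:E)%E.
    apply: eq_integral => t _.
    rewrite /F/=.
    have [tab|tab] := boolP (t \in `[a, b]%classic); last first.
      have -> : g t = 0 by rewrite /g patchE (negbTE tab).
      by under eq_integral do rewrite mul0r; rewrite integral0.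
    have t0 : 0 < t.
      by move: tab; rewrite inE/= in_itv/= => /andP[? _]; exact: lt_le_trans a0 _.
    under eq_integral do rewrite EFinM.
    rewrite ge0_integralZl//=.
    - by rewrite integral_scale ?powR_gt0// p1 mule1.
    - apply/measurable_EFinP; apply: measurable_funM => //.
      by apply: measurableT_comp => //; exact: measurable_funM.
    - by move=> x _; rewrite lee_fin mulr_ge0// powR_ge0.
    - by rewrite lee_fin.
  rewrite -[RHS]integral_mkcond.
  rewrite (_ : (fun t => (g t)%:E) = (fun t => (g t)%:E) \_ `[a, b]); last first.
    apply/funext => t; rewrite patchE; case: ifPn => // tab.
    by rewrite /g patchE (negbTE tab).
  rewrite -[LHS]integral_mkcond; apply: ae_eq_integral => //.
  - by apply/measurable_EFinP; exact: measurable_funTS.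
  - by apply/measurable_EFinP; exact: measurable_funTS.
  by apply: (@filterS _ _ (ae_filter_ringOfSetsType mu) _ _ _ fg) => t /= ftg tab; rewrite ftg.
have iG : mu.-integrable setT G.
  apply/integrableP; split => //.
  under eq_integral do rewrite gee0_abs//.
  by rewrite intG ltry.
have mfG : measurable_fun setT (fine \o G).
  by apply: measurableT_comp => //; exact: fine_measurable.
split.
- by rewrite (_ : mixture pi1 f = fine \o G)//; apply/funext.
- by move=> x; rewrite mixE fine_ge0.
rewrite -intG; apply: ae_eq_integral => //.
  apply/measurable_EFinP.
  by rewrite (_ : mixture pi1 f = fine \o G)//; apply/funext.
by apply: (@filterS _ _ (ae_filter_ringOfSetsType mu) _ _ _ (integrable_ae measurableT iG)) => x /= + _ => /(_ I) ?; rewrite mixE fineK.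
Qed.
End mixture_density.

Section derivative.
Context {R : realType}.

(* a one-sided derivative when x is an endpoint of the interval D *)
Definition has_derivative_within (D : set R) (g : R -> R) (x l : R) : Prop :=
  (g y - g x) / (y - x) @[y --> within D x^'] --> l.

Definition bounded_kth_derivative_within (D : set R) (k : nat) (g : R -> R) :
    Prop :=
  exists dg : nat -> R -> R,
    [/\ (forall x, D x -> dg 0%N x = g x),
        (forall j x, (j < k)%N -> D x ->
           has_derivative_within D (dg j) x (dg j.+1 x)) &
        exists M : R, forall x, D x -> `|dg k x| <= M].

End derivative.

(* Main.v *)
(* Two-point lower bound.  The uniform mixing density f0 = 1/(b-a) is compared
   with f1 = f0 + B V, where V is the s-th derivative of chi(t) cos(m t) or
   chi(t) sin(m t), divided by m^s; here s = k-1, chi is a polynomial bump with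
   zeros of order k at a and b, B is of order m^-alpha and m = n^(1/(k-alpha)).

   - V and the quotients V^(j) / m^j are bounded uniformly in m, so that f1 lies
     in the smoothness class; the squares of the two versions of V add up to
     chi^2 + O(1/m), so that one of them has L2 norm bounded below.
   - Integrating by parts s times against t |-> pi_t(x), which has k-1 continuous
     derivatives, shows that the two mixture densities differ by O(B m^-s) on a
     fixed compact interval and coincide outside of it; hence the n-fold product
     laws are at distance O(n B m^-s) = O(m^(1 - 2 alpha)), which tends to 0.
   - Le Cam's inequality then bounds the risk below by a multiple of
     B^2, which is of order n^(-2 alpha/(k-alpha)). *)

Require Import Defs.
From HB Require Import structures.
From mathcomp Require Import all_boot all_order all_algebra.
From mathcomp Require Import all_classical all_reals all_analysis.
From mathcomp Require Import measurable_realfun ring lra.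

Set Implicit Arguments.
Unset Strict Implicit.
Unset Printing Implicit Defensive.

Import Order.TTheory GRing.Theory Num.Theory.
Import numFieldNormedType.Exports.

Local Open Scope classical_set_scope.
Local Open Scope ring_scope.

(** * Product laws and Le Cam's two-point bound *)

(** Coordinates are exchanged one at a time: replacing [P] by [Q] in one factor costs at most the
    mass of [D], because the integrand is a probability. The measure [D] dominates the excess of [P]
    over [Q] and stands in for their total variation distance. *)
Lemma iid_law_le (R : realType) (P Q : probability (measurableTypeR R) R)
    (D : {measure set (measurableTypeR R) -> \bar R}) (delta : R) (n : nat)
    (A : set (n.-tuple (measurableTypeR R))) :
  (forall B, measurable B -> (P B <= Q B + D B)%E) ->
  (D setT <= delta%:E)%E -> measurable A ->
  (iid_law P n A <= iid_law Q n A + (n%:R * delta)%:E)%E.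
Proof.
move=> PQD Ddelta; elim: n A => [|n IH] A mA /=; first by rewrite mul0r adde0.
rewrite /distribution /pushforward.
set A' := _ @^-1` A.
have mA' : measurable A'.
  by rewrite -[A']setTI; exact: measurable_tuple_cons.
have mQ : measurable_fun setT (fun x => iid_law Q n (xsection A' x)).
  exact: measurable_fun_xsection.
have Q0 x : (0 <= iid_law Q n (xsection A' x))%E by [].
have D0 : (0 <= delta)%R by rewrite -lee_fin (le_trans _ Ddelta).
have step1 : ((P \x iid_law P n) A' <=
    \int[P]_x iid_law Q n (xsection A' x) + (n%:R * delta)%:E)%E.
  rewrite /product_measure1.
  apply: (@le_trans _ _
    (\int[P]_x (iid_law Q n (xsection A' x) + (n%:R * delta)%:E))%E).
    apply: ge0_le_integral => //=.
    - exact: measurable_fun_xsection.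
    - exact: emeasurable_funD.
    - by move=> x _; apply: IH; exact: measurable_xsection.
  rewrite ge0_integralD//=; last by move=> x _; rewrite lee_fin mulr_ge0.
  rewrite integral_cst//= -[X in (_ * X)%E]/(P setT) probability_setT mule1; exact: lexx.
apply: (le_trans step1).
apply: (@le_trans _ _ (\int[measure_add Q D]_x iid_law Q n (xsection A' x) +
    (n%:R * delta)%:E)%E).
  apply: leeD => //; apply: ge0_le_measure_integral => //.
  by move=> S mS; rewrite [leRHS]measure_addE; exact: PQD.
rewrite ge0_integral_measure_add// -addeA; apply: leeD => //.
rewrite -[n.+1%:R]natr1 mulrDl mul1r addrC EFinD; apply: leeD => //.
apply: le_trans Ddelta.
rewrite -[leRHS]mul1e -(integral_cst D measurableT 1%E).
apply: ge0_le_integral => //= x _; apply: probability_le1.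
exact: measurable_xsection.
Qed.

(* Unlike [ge0_le_integral], no measurability is needed. *)
Lemma ge0_integral_mono d (T : measurableType d) (R : realType)
    (mu : {measure set T -> \bar R}) (D : set T) (f g : T -> \bar R) :
  (forall x, D x -> (0 <= f x <= g x)%E) ->
  (\int[mu]_(x in D) f x <= \int[mu]_(x in D) g x)%E.
Proof.
move=> fg.
have f0 x : D x -> (0 <= f x)%E by move=> /fg /andP[].
have g0 x : D x -> (0 <= g x)%E by move=> /fg /andP[]; exact: le_trans.
rewrite !ge0_integralE// ge_ereal_sup// => _ [h /= hf] <-.
apply: ereal_sup_ubound; exists h => //= x; apply: (le_trans (hf x)).
rewrite !patchE; case: ifPn => // /[!inE] /fg/andP[//].
Qed.

Lemma integral_ge_cst d (T : measurableType d) (R : realType)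
    (mu : {measure set T -> \bar R}) (A : set T) (c : \bar R) (g : T -> \bar R) :
  measurable A -> (0 <= c)%E -> (forall x, 0 <= g x)%E ->
  (forall x, A x -> c <= g x)%E -> (c * mu A <= \int[mu]_x g x)%E.
Proof.
move=> mA c0 g0 cg; rewrite -integral_cst// [leLHS]integral_mkcond.
apply: ge0_integral_mono => x _; rewrite patchE.
case: ifPn => [/[!inE] Ax|_]; last by rewrite lexx g0.
by rewrite c0 cg.
Qed.

Section two_points.
Context {R : realType} (a b : R).
Implicit Types f g h : L2 a b.

Lemma L2distC f g : L2dist f g = L2dist g f.
Proof.
rewrite /L2dist /L2norm -[LHS]oppe_Lnorm; apply: eq_Lnorm => x /=.
by rewrite opprB.
Qed.

Lemma L2dist_triangle g f h : (L2dist f h <= L2dist f g + L2dist g h)%E.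
Proof.
rewrite /L2dist /L2norm.
have mf (f' : L2 a b) : measurable_fun setT (f' : R -> R).
  exact: (measurable_funPT f').
have mfB (u v : L2 a b) : measurable_fun setT (fun t => u t - v t).
  exact: (measurable_funB (mf u) (mf v)).
have := eminkowski (lebesgue_ab a b) (mfB f g) (mfB g h) (lee1n 2).
apply: le_trans; rewrite le_eqVlt; apply/orP; left; apply/eqP/eq_Lnorm => x /=.
by rewrite addrA subrK.
Qed.

(** Estimators pull open sets back to measurable sets, so this makes closeness of an estimator to a
    hypothesis a measurable event. *)
Lemma L2open_ball f (e : R) : L2open [set g | (L2dist g f < e%:E)%E].
Proof.
move=> g /=; have := Lnorm_ge0 (lebesgue_ab a b) 2%:E (EFin \o (fun t => g t - f t)).
rewrite -/(L2norm a b (fun t => g t - f t)) -/(L2dist g f).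
case E : (L2dist g f) => [r||]//; rewrite ?lte_fin ?lee_fin => r0 re.
exists (e - r); first by rewrite subr_gt0.
move=> h /= hg; apply: (le_lt_trans (L2dist_triangle g h f)).
rewrite E -[e](subrK r) EFinD; apply: lte_leD => //.
Qed.

Lemma sqre_ge (x : \bar R) (r : R) : 0 <= r -> (r%:E <= x)%E ->
  ((r ^+ 2)%:E <= x ^+ 2)%E.
Proof.
move=> r0 rx; rewrite expr2 EFinM expe2; apply: lee_pmul => //.
Qed.

(* Le Cam's two-point bound: an estimator close to [f1] is far from [f0], so
   that it tests between the two hypotheses. *)
Lemma two_point_risk (pi1 : R -> R) (F : set (L2 a b)) (n : nat) (f0 f1 : L2 a b)
    (d : R) : 0 <= d -> F f0 -> F f1 -> (d%:E <= L2dist f1 f0)%E ->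
  (forall A, measurable A ->
    (iid_law (density_law (mixture pi1 f1)) n A <=
     iid_law (density_law (mixture pi1 f0)) n A + (2^-1)%:E)%E) ->
  ((d ^+ 2 / 16)%:E <= minimax_risk pi1 F n)%E.
Proof.
move=> d0 F0 F1 df P10; apply: le_ereal_inf_tmp => _ [fhat mfhat] <-.
pose P0 := iid_law (density_law (mixture pi1 f0)) n.
pose P1 := iid_law (density_law (mixture pi1 f1)) n.
pose A := fhat @^-1` [set g | (L2dist g f1 < (d / 2)%:E)%E].
have mA : measurable A by apply: mfhat; exact: L2open_ball.
have d20 : 0 <= d / 2 by rewrite divr_ge0.
have dist0 (f : L2 a b) X : (0 <= L2dist (fhat X) f ^+ 2)%E.
  by rewrite expe2 mule_ge0// Lnorm_ge0.
have r1 : (((d / 2) ^+ 2)%:E * P1 (~` A) <= risk pi1 fhat f1)%E.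
  apply: integral_ge_cst => //.
  - exact: measurableC.
  - by rewrite lee_fin sqr_ge0.
  - move=> X /= /negP; rewrite -leNgt; exact: sqre_ge.
have r0 : (((d / 2) ^+ 2)%:E * P0 A <= risk pi1 fhat f0)%E.
  apply: integral_ge_cst => //; first by rewrite lee_fin sqr_ge0.
  move=> X /= Xf1; apply: sqre_ge => //; rewrite leNgt; apply/negP => Xf0.
  have := L2dist_triangle (fhat X) f1 f0; apply/negP; rewrite -ltNge.
  apply: lt_le_trans df; rewrite [in ltRHS](splitr d) EFinD L2distC.
  by apply: lteD.
have -> : d ^+ 2 / 16 = (d / 2) ^+ 2 * 4^-1 by field.
(* If [P0 A] is at least 1/4, the risk at [f0] is large, since on [A] the estimator stays at
   distance at least d/2 from [f0]. Otherwise [P1 A] is below 3/4 and the complement of [A] makes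
   the risk at [f1] large. *)
have [p0|p0] := leP (4^-1)%:E (P0 A).
  apply: (@le_trans _ _ (risk pi1 fhat f0)); last first.
    by apply: ereal_sup_ubound; exists f0.
  by apply: le_trans r0; rewrite EFinM lee_pmul ?lee_fin ?sqr_ge0 ?invr_ge0.
apply: (@le_trans _ _ (risk pi1 fhat f1)); last first.
  by apply: ereal_sup_ubound; exists f1.
apply: le_trans r1; rewrite EFinM lee_pmul ?lee_fin ?sqr_ge0 ?invr_ge0//.
rewrite [leRHS]probability_setC//.
suff arith (x y : \bar R) : x \is a fin_num -> y \is a fin_num ->
    (x < (4^-1)%:E)%E -> (y <= x + (2^-1)%:E)%E -> ((4^-1)%:E <= 1 - y)%E.
  apply: (arith (P0 A) (P1 A)) => //; last exact: P10.
    exact: fin_num_measure.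
  exact: fin_num_measure.
case: x y => [x||] [y||]// _ _.
rewrite lte_fin -EFinD -EFinB !lee_fin => ? ?; lra.
Qed.

End two_points.

(** * The smoothness class *)

Section L2norm_bounds.
Context {R : realType} (a b : R).

Lemma L2normE (f : R -> R) :
  L2norm a b f = ((\int[lebesgue_ab a b]_x ((f x) ^+ 2)%:E) `^ 2^-1)%E.
Proof.
rewrite /L2norm unlock; congr (_ `^ _)%E; apply: eq_integral => x _ /=.
by rewrite powR_mulrn// real_normK ?num_real.
Qed.

(** The comparison is pointwise on the whole line: the dominating function is [S ^+ 2] on [a, b] and
    infinite on the complement, a null set. In this form it applies directly to finite differences
    whose step depends on the point. *)
Lemma L2norm_le (f : R -> R) (S : R) : a <= b -> 0 <= S ->
  (forall x, x \in `[a, b] -> `|f x| <= S) ->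
  (L2norm a b f <= (S * (b - a) `^ 2^-1)%:E)%E.
Proof.
move=> ab S0 fS; rewrite L2normE.
have -> : S * (b - a) `^ 2^-1 = (S ^+ 2 * (b - a)) `^ 2^-1.
  rewrite powRM ?sqr_ge0 ?subr_ge0// -powR_mulrn// -powRrM mulfV// powRr1//.
rewrite -poweR_EFin; apply: gt0_ler_poweR => //.
- by rewrite in_itv/= integral_ge0 ?leey// => x _; rewrite lee_fin sqr_ge0.
- by rewrite in_itv/= leey andbT lee_fin mulr_ge0 ?sqr_ge0 ?subr_ge0.
have muab : lebesgue_ab a b setT = (b - a)%:E.
  rewrite /lebesgue_ab /= /mrestr setTI lebesgue_measure_itv/= lte_fin.
  case: ltP => // ba; rewrite -?EFinB//; have -> : a = b by apply/eqP; rewrite eq_le ab.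
  by rewrite subrr.
have muabC : lebesgue_ab a b (~` `[a, b]) = 0%E.
  by rewrite /lebesgue_ab /= /mrestr setICl measure0.
rewrite EFinM -muab -(adde0 (_ * _)%E) -(mule0 +oo%E) -muabC.
rewrite -!integral_cst//; last exact: measurableC.
rewrite [X in (_ <= _ + X)%E]integral_mkcond.
rewrite -ge0_integralD//=; first last.
- by apply/(measurable_restrictT _ (measurableC (measurable_itv _))).
- by move=> x _; rewrite patchE; case: ifPn => _ /=; rewrite ?lexx ?leey.
- by move=> x _; rewrite lee_fin sqr_ge0.
apply: ge0_integral_mono => x _; rewrite lee_fin sqr_ge0/=.
rewrite patchE; case: ifPn => [_|]; first by rewrite /= addey ?leey.
rewrite notin_setE/= => /contrapT xab; rewrite adde0 lee_fin.
by rewrite -(real_normK (num_real (f x))) ler_sqr ?nnegrE// fS.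
Qed.

End L2norm_bounds.

(** * Finite differences and the weighted modulus of smoothness *)

Section finite_differences.
Context {R : realType}.
Implicit Types (f : R -> R) (r : nat) (h x y z : R).

(** The forward form of [Delta], started at the leftmost node: it suits induction on [r], as the
    nodes no longer depend on [r] through a centring. *)
Definition fdiff r h f y : R :=
  \sum_(i < r.+1) 'C(r, i)%:R * (-1) ^+ i * f (y + i%:R * h).

(** Pascal's rule, after shifting the index in the second sum. *)
Lemma fdiffS r h f y :
  fdiff r.+1 h f y = fdiff r h (fun z => f z - f (z + h)) y.
Proof.
rewrite /fdiff.
have -> : \sum_(i < r.+1) 'C(r, i)%:R * (-1) ^+ i *
      (f (y + i%:R * h) - f (y + i%:R * h + h)) =
    \sum_(i < r.+1) 'C(r, i)%:R * (-1) ^+ i * f (y + i%:R * h) +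
    \sum_(i < r.+1) 'C(r, i)%:R * (-1) ^+ i.+1 * f (y + i.+1%:R * h).
  rewrite -big_split/=; apply: eq_bigr => i _.
  rewrite exprS -[i.+1%:R]natr1 mulrDl mul1r addrA; ring.
have -> : \sum_(i < r.+1) 'C(r, i)%:R * (-1) ^+ i * f (y + i%:R * h) =
    \sum_(i < r.+2) 'C(r, i)%:R * (-1) ^+ i * f (y + i%:R * h).
  by rewrite [RHS]big_ord_recr/= bin_small// !mul0r addr0.
rewrite big_ord_recl [in RHS]big_ord_recl -addrA; congr (_ + _).
  by rewrite !bin0.
rewrite -big_split/=; apply: eq_bigr => i _.
by rewrite /bump/= add1n binS natrD !mulrDl.
Qed.

(** Differences of positive order kill constants, so the uniform density does not contribute to the
    modulus of smoothness. *)
Lemma fdiffD_cst c r h f y : fdiff r.+1 h (fun z => c + f z) y = fdiff r.+1 h f y.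
Proof.
rewrite !fdiffS; congr fdiff; apply/funext => z; ring.
Qed.

Lemma fdiffZ c r h f y : fdiff r h (fun z => c * f z) y = c * fdiff r h f y.
Proof.
by rewrite /fdiff mulr_sumr; apply: eq_bigr => i _; rewrite mulrCA.
Qed.

(** Each difference at most doubles the supremum over the nodes. *)
Lemma fdiff_le r h f y S : 0 <= h ->
  (forall z, y <= z <= y + r%:R * h -> `|f z| <= S) ->
  `|fdiff r h f y| <= 2 ^+ r * S.
Proof.
move=> h0; elim: r f S => [|r IH] f S fS.
  rewrite /fdiff big_ord_recl big_ord0 bin0 addr0 mul0r addr0 !expr0 !mul1r.
  by apply: fS; rewrite lexx mul0r addr0 lexx.
rewrite fdiffS exprSr -mulrA; apply: IH => z /andP[yz zy].
rewrite (le_trans (ler_normB _ _))// mulr_natl mulr2n lerD// fS//.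
  by rewrite yz (le_trans zy)// lerD2l ler_wpM2r// ler_nat.
rewrite (le_trans yz) ?lerDl//=.
by rewrite -natr1 mulrDl mul1r addrA lerD2r.
Qed.

(** Each difference trades one derivative for a factor [h], by the mean value theorem; the induction
    runs on the differenced sequence of derivatives. *)
Lemma fdiff_deriv_le r h (f : nat -> R -> R) y S : 0 <= h ->
  (forall j z, is_derive z 1 (f j) (f j.+1 z)) ->
  (forall z, y <= z <= y + r%:R * h -> `|f r z| <= S) ->
  `|fdiff r h (f 0%N) y| <= h ^+ r * S.
Proof.
move=> h0; elim: r f S => [|r IH] f S df fS.
  have := @fdiff_le 0 h (f 0%N) y S h0 fS.
  by rewrite !expr0.
rewrite fdiffS exprSr -mulrA.
apply: (IH (fun j z => f j z - f j (z + h))).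
  move=> j z; apply: is_deriveB.
  have := @is_derive1_comp _ (f j) (fun z => z + h) z (f j.+1 (z + h)) 1 (df _ _).
  rewrite mulr1; apply.
  rewrite -[X in is_derive _ _ _ X]addr0; apply: is_deriveD.
move=> z /andP[yz zy].
have [||c] := @MVT_segment _ (f r) (f r.+1) z (z + h) _ (fun x _ => df r x).
- by rewrite lerDl.
- apply: continuous_subspaceT => x.
  apply/differentiable_continuous/derivable1_diffP.
  exact: (@ex_derive _ _ _ _ _ _ _ (df r x)).
rewrite in_itv/= => /andP[zc ch] E.
rewrite distrC E addrAC subrr add0r normrM (ger0_norm h0) mulrC ler_wpM2l//.
apply: fS; rewrite (le_trans yz zc)/= (le_trans ch)//.
by rewrite -natr1 mulrDl mul1r addrA lerD2r.
Qed.

Lemma DeltaE a b r h f x : Delta a b r h f x =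
  if (x + r%:R * h / 2 \in `[a, b]) && (x - r%:R * h / 2 \in `[a, b])
  then fdiff r h f (x - r%:R * h / 2) else 0.
Proof.
rewrite /Delta; case: ifP => // _; apply: eq_bigr => i _; congr (_ * f _).
by field.
Qed.

Lemma phi_le (a b x : R) : a <= b -> x \in `[a, b] -> phi a b x <= b - a.
Proof.
move=> ab; rewrite in_itv/= => /andP[ax xb].
have ba0 : 0 <= b - a by rewrite subr_ge0.
rewrite /phi -[leRHS](ger0_norm ba0) -sqrtr_sqr ler_wsqrtr// expr2.
by apply: ler_pM; rewrite ?subr_ge0// lerD ?lerN2.
Qed.

(** With local step [e = h * phi x], there are two regimes. If [m * e >= 1], the crude bound
    [2 ^+ r.+1 * S] is enough because [(m * e) ^ alpha >= 1]. If [m * e < 1], the derivative bound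
    gives [(m * e) ^+ r.+1 * S], which is at most [(m * e) ^ alpha * S] since [alpha <= r.+1].
    Finally [e <= (b - a) * t]. *)
Lemma omega_phi_le (a b alpha B S m c t : R) r (v : nat -> R -> R) :
  a < b -> 0 <= alpha <= r.+1%:R -> 0 <= B -> 0 <= S -> 0 < m -> 0 < t ->
  (forall j z, is_derive z 1 (v j) (v j.+1 z)) ->
  (forall z, z \in `[a, b] -> `|v 0%N z| <= S) ->
  (forall z, z \in `[a, b] -> `|v r.+1 z| <= m ^+ r.+1 * S) ->
  (omega_phi a b r.+1 (fun x => c + B * v 0%N x)%R t <=
   (B * 2 ^+ r.+1 * S * (b - a) `^ 2^-1 * (m * (b - a)) `^ alpha *
     t `^ alpha)%:E)%E.
Proof.
move=> ab /andP[al0 alr] B0 S0 m0 t0 dv v0 vr; apply: ge_ereal_sup => _ /= [h /andP[h0 ht] <-].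
have ba0 : 0 <= b - a by rewrite subr_ge0 ltW.
have m0' := ltW m0; have t0' := ltW t0; have ab' := ltW ab.
have K0 : 0 <= B * 2 ^+ r.+1 * S * ((m * (b - a)) `^ alpha * t `^ alpha).
  by rewrite !mulr_ge0 ?exprn_ge0 ?powR_ge0.
have -> : B * 2 ^+ r.+1 * S * (b - a) `^ 2^-1 * (m * (b - a)) `^ alpha *
     t `^ alpha = B * 2 ^+ r.+1 * S * ((m * (b - a)) `^ alpha * t `^ alpha) *
     (b - a) `^ 2^-1 by ring.
apply: L2norm_le => //.
move=> x xab; rewrite DeltaE; case: ifP => [|_]; last by rewrite normr0.
set e := h * phi a b x; set y := x - _ => /andP[yb ya].
have e0 : 0 <= e by rewrite mulr_ge0 ?sqrtr_ge0// ltW.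
have eh : e <= (b - a) * t.
  by rewrite mulrC; apply: ler_pM; rewrite ?sqrtr_ge0 ?phi_le// ltW.
(* [Delta] is zero unless both extreme nodes lie in [a, b], so the bounds on [v] hold at all nodes
   and between them. *)
have inab z : y <= z <= y + r.+1%:R * e -> z \in `[a, b].
  move=> /andP[yz zy]; move: ya yb; rewrite !in_itv/= => /andP[ya _] /andP[_ yb].
  rewrite (le_trans ya yz) (le_trans zy)// (le_trans _ yb)//.
  by rewrite /y -addrA lerD2l; lra.
rewrite fdiffD_cst fdiffZ normrM (ger0_norm B0) -!mulrA ler_wpM2l// mulrA.
rewrite -powRM ?mulr_ge0// -mulrA.
have me0 : 0 <= m * e by exact: mulr_ge0.
have key : (m * e) `^ alpha <= (m * (b - a) * t) `^ alpha.
  apply: ge0_ler_powR => //; rewrite ?nnegrE ?mulr_ge0//.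
  by rewrite -mulrA ler_wpM2l.
have [me|me] := leP 1 (m * e).
  apply: (@le_trans _ _ (2 ^+ r.+1 * S)).
    by apply: fdiff_le => // z /inab; exact: v0.
  rewrite mulrA -[leLHS]mulr1 ler_wpM2l ?mulr_ge0//.
  have me1 : 1 <= (m * e) `^ alpha by rewrite -[leLHS](powRr0 (m * e)) ler_powR.
  exact: le_trans me1 key.
apply: (@le_trans _ _ (e ^+ r.+1 * (m ^+ r.+1 * S))).
  by apply: fdiff_deriv_le => // z /inab; exact: vr.
rewrite mulrA -exprMn (mulrC e).
apply: (@le_trans _ _ (S * (m * e) `^ alpha)).
  rewrite [leLHS]mulrC ler_wpM2l//.
  have [->|me1] := eqVneq (m * e) 0; first by rewrite expr0n powR_ge0.
  rewrite -powR_mulrn//; apply: ger_powR alr.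
  by rewrite lt0r me1 me0 ltW.
rewrite mulrA ler_pM ?powR_ge0// ler_peMl// exprn_ege1// ler1n//.
Qed.
End finite_differences.

(** * Oscillating perturbations *)

Section wave.
Context {R : realType}.
Implicit Types (u w : nat -> R -> R) (m t : R) (i j : nat).

Definition deriv_seq u := forall i t, is_derive t 1 (u i) (u i.+1 t).

(* The pair [(P, Q)] such that [P cos (m t) + Q sin (m t)] is [m ^- j] times the
   [j]-th derivative of [u cos (m t) + w sin (m t)]; the index of [u], [w], [P]
   and [Q] counts derivatives. *)
Fixpoint amplitudes m u w j : (nat -> R -> R) * (nat -> R -> R) :=
  if j is j'.+1 then
    let PQ := amplitudes m u w j' in
    (fun i t => m^-1 * PQ.1 i.+1 t + PQ.2 i t,
     fun i t => m^-1 * PQ.2 i.+1 t - PQ.1 i t)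
  else (u, w).

Definition wave m u w j t : R :=
  (amplitudes m u w j).1 0%N t * cos (m * t) +
  (amplitudes m u w j).2 0%N t * sin (m * t).

Lemma deriv_seq_amplitudes m u w j : deriv_seq u -> deriv_seq w ->
  deriv_seq (amplitudes m u w j).1 /\ deriv_seq (amplitudes m u w j).2.
Proof.
move=> du dw; elim: j => //= j [dP dQ]; split=> i t.
  by apply: is_deriveD => //; apply: is_deriveZ.
by apply: is_deriveB => //; apply: is_deriveZ.
Qed.

Lemma is_derive_wave m u w j t : m != 0 -> deriv_seq u -> deriv_seq w ->
  is_derive t 1 (wave m u w j) (m * wave m u w j.+1 t).
Proof.
move=> m0 du dw; have [dP dQ] := deriv_seq_amplitudes m j du dw.
have dmt : is_derive t 1 (fun t => m * t) m.
  by rewrite -[X in is_derive _ _ _ X]mulr1; apply: is_deriveZ.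
have dc := @is_derive1_comp _ cos (fun t => m * t) t _ _ (is_derive_cos (m * t)) dmt.
have ds := @is_derive1_comp _ sin (fun t => m * t) t _ _ (is_derive_sin (m * t)) dmt.
have dPt := dP 0%N t; have dQt := dQ 0%N t.
have D := is_deriveD (is_deriveM dPt dc) (is_deriveM dQt ds).
apply: (is_derive_eq D).
rewrite /wave /= /GRing.scale/=.
set P := (amplitudes _ _ _ _).1; set Q := (amplitudes _ _ _ _).2.
by field.
Qed.

(** As [m >= 1], the factor [m^-1] in the recursion is at most 1, whence a constant that does not
    depend on [m]. *)
Lemma amplitudes_bounded (D : set R) u w j i :
  (forall i, exists M, forall t, D t -> `|u i t| <= M /\ `|w i t| <= M) ->
  exists2 M, 0 <= M & forall m t, 1 <= m -> D t ->
    `|(amplitudes m u w j).1 i t| <= M /\ `|(amplitudes m u w j).2 i t| <= M.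
Proof.
move=> uw; elim: j i => [|j IH] i.
  have [M uwM] := uw i; exists `|M| => // m t _ Dt /=.
  by have [? ?] := uwM t Dt; split; apply: le_trans (ler_norm M).
have [M M0 HM] := IH i; have [M' M'0 HM'] := IH i.+1.
exists (M' + M); first by rewrite addr_ge0.
move=> m t m1 Dt /=; have [P Q] := HM m t m1 Dt; have [P' Q'] := HM' m t m1 Dt.
have m0 : 0 < m by exact: lt_le_trans m1.
have im x : `|x| <= M' -> `|m^-1 * x| <= M'.
  move=> xM; rewrite normrM ger0_norm ?invr_ge0 ?(ltW m0)//.
  by rewrite (le_trans _ xM)// ler_piMl// invf_le1.
split; first by rewrite (le_trans (ler_normD _ _))// lerD// im.
by rewrite (le_trans (ler_normB _ _))// lerD// im.
Qed.

Lemma wave_bounded (D : set R) u w j :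
  (forall i, exists M, forall t, D t -> `|u i t| <= M /\ `|w i t| <= M) ->
  exists2 M, 0 <= M & forall m t, 1 <= m -> D t -> `|wave m u w j t| <= M.
Proof.
move=> /(amplitudes_bounded j 0%N)[M M0 HM]; exists (M + M); first exact: addr_ge0.
move=> m t m1 Dt; have [P Q] := HM m t m1 Dt.
rewrite (le_trans (ler_normD _ _))// !normrM lerD//.
  by rewrite (le_trans _ P)// ler_piMr// ler_norml cos_geN1 cos_le1.
by rewrite (le_trans _ Q)// ler_piMr// ler_norml sin_geN1 sin_le1.
Qed.

(** Amplitudes of level [j] only involve derivatives of [u] and [w] up to order [j]: the entry [i']
    at level [i] uses orders up to [i + i']. *)
Lemma wave_eq0 m u w j t :
  (forall i, (i <= j)%N -> u i t = 0 /\ w i t = 0) -> wave m u w j t = 0.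
Proof.
move=> uw.
suff H i : (i <= j)%N -> forall i', (i + i' <= j)%N ->
    (amplitudes m u w i).1 i' t = 0 /\ (amplitudes m u w i).2 i' t = 0.
  have [] := H j (leqnn j) 0%N; first by rewrite addn0.
  by rewrite /wave => -> ->; rewrite !mul0r addr0.
elim: i => [|i IH] ij i' ii' /=; first by apply: uw.
have [|P Q] := IH (ltnW ij) i'; first by rewrite (leq_trans _ ii')// leq_add2r.
have [|P' Q'] := IH (ltnW ij) i'.+1; first by rewrite addnS.
by rewrite P Q P' Q' mulr0 addr0 subr0.
Qed.

(** Replacing [(u, w)] by [(- w, u)] shifts the phase by a quarter period, and the recursion
    commutes with this rotation. *)
Lemma amplitudes_rot m u w j : amplitudes m (fun i t => - w i t) u j =
  (fun i t => - (amplitudes m u w j).2 i t, (amplitudes m u w j).1).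
Proof.
elim: j => //= j ->; congr (_, _); apply/funext => i; apply/funext => t /=; ring.
Qed.

Lemma wave_rot m u w j t :
  wave m u w j t ^+ 2 + wave m (fun i t => - w i t) u j t ^+ 2 =
  (amplitudes m u w j).1 0%N t ^+ 2 + (amplitudes m u w j).2 0%N t ^+ 2.
Proof.
rewrite /wave amplitudes_rot/=.
set P := (amplitudes _ _ _ _).1 _ _; set Q := (amplitudes _ _ _ _).2 _ _.
rewrite -[RHS]mulr1 -(cos2Dsin2 (m * t)); ring.
Qed.

(** One step of the recursion rotates the pair by a quarter turn and adds terms of order 1/m: the
    sum of squares changes by cross terms, bounded by a multiple of 1/m, and by nonnegative
    squares. *)
Lemma amplitudes_sqr_ge (D : set R) u w j :
  (forall i, exists M, forall t, D t -> `|u i t| <= M /\ `|w i t| <= M) ->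
  exists2 K, 0 <= K & forall m t, 1 <= m -> D t ->
    u 0%N t ^+ 2 + w 0%N t ^+ 2 - K / m <=
    (amplitudes m u w j).1 0%N t ^+ 2 + (amplitudes m u w j).2 0%N t ^+ 2.
Proof.
move=> uw; elim: j => [|j [K K0 HK]].
  by exists 0 => // m t m1 Dt /=; rewrite mul0r subr0.
have [M M0 HM] := amplitudes_bounded j 0 uw.
have [M' M'0 HM'] := amplitudes_bounded j 1 uw.
(* The increment bounds the cross terms [2 * m^-1 * (P' * Q - Q' * P)]. *)
exists (K + 4 * (M * M')); first by rewrite addr_ge0 ?mulr_ge0.
move=> m t m1 Dt /=; have := HK m t m1 Dt.
have [] := HM m t m1 Dt; have [] := HM' m t m1 Dt.
set P := (amplitudes _ _ _ _).1 0%N t; set Q := (amplitudes _ _ _ _).2 0%N t.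
set P' := (amplitudes _ _ _ _).1 1%N t; set Q' := (amplitudes _ _ _ _).2 1%N t.
move=> hP' hQ' hP hQ.
have m0 : 0 < m by exact: lt_le_trans m1.
have e0 : 0 <= m^-1 by rewrite invr_ge0 ltW.
have h1 : - (M * M') <= P' * Q.
  have : `|P' * Q| <= M * M' by rewrite normrM mulrC ler_pM.
  by rewrite ler_norml => /andP[].
have h2 : Q' * P <= M * M'.
  have : `|Q' * P| <= M * M' by rewrite normrM mulrC ler_pM.
  by rewrite ler_norml => /andP[].
rewrite -[K / m]/(K * m^-1) -[(K + _) / m]/((K + _) * m^-1).
move: (m^-1) e0 => e e0 HK'.
have -> : (e * P' + Q) ^+ 2 + (e * Q' - P) ^+ 2 =
  P ^+ 2 + Q ^+ 2 + 2 * (e * (P' * Q - Q' * P)) + ((e * P') ^+ 2 + (e * Q') ^+ 2) by ring.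
have : e * (- (M * M') - M * M') <= e * (P' * Q - Q' * P).
  by rewrite ler_wpM2l// lerB.
have := sqr_ge0 (e * P'); have := sqr_ge0 (e * Q'); lra.
Qed.

End wave.

(** * A polynomial bump with zeros of high order at the endpoints *)

Section bump.
Context {R : realType}.
Variables (a b : R) (N : nat).
Local Notation q := (('X - a%:P) * ('X - b%:P)).

(** The zeros of order [N] at [a] and [b] are there to remove the boundary terms of the integrations
    by parts. *)
Definition bump (i : nat) : R -> R := horner ((q ^+ N)^`(i)).

Lemma deriv_seq_bump : deriv_seq bump.
Proof.
move=> i t; rewrite /bump derivnS derivE derive1E; apply: derivableP.
exact: derivable_horner.
Qed.

(** Each differentiation removes at most one factor [p]; the cofactor [s] absorbs what the Leibniz
    rule produces. *)
Lemma derivn_exp_dvd (p s : {poly R}) i n :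
  exists r, (p ^+ (n + i) * s)^`(i) = p ^+ n * r.
Proof.
elim: i s => [|i IH] s; first by exists s; rewrite addn0.
have [r Er] := IH (p^`() * s *+ (n + i.+1) + p * s^`()).
exists r; rewrite derivSn -Er; congr (_^`(_)).
rewrite derivM deriv_exp addnS /= exprSr mulrDr; congr (_ + _).
  by rewrite mulrnAl mulrnAr (mulrC p^`()) mulrA.
by rewrite mulrA.
Qed.

Lemma bump_eq0 (i : nat) (c : R) : (i < N)%N -> c = a \/ c = b -> bump i c = 0.
Proof.
move=> iN cab; have [r Er] := derivn_exp_dvd q 1 i (N - i).
move: Er; rewrite subnK ?mulr1 1?ltnW// /bump => ->.
rewrite hornerM horner_exp !hornerE.
have -> : (c - a) * (c - b) = 0 by case: cab => ->; rewrite subrr ?mul0r ?mulr0.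
by rewrite expr0n subn_eq0 leqNgt iN mul0r.
Qed.

Lemma bump_bounded i : 0 < a ->
  exists M, forall t, t \in `[a, b] -> `|bump i t| <= M.
Proof.
move=> a0; rewrite /bump; set p := _^`(i).
exists (\sum_(j < size p) `|p`_j| * b ^+ j) => t; rewrite in_itv/= => /andP[at_ tb].
have t0 : 0 <= t by rewrite (le_trans _ at_)// ltW.
rewrite horner_coef (le_trans (ler_norm_sum _ _ _))// ler_sum// => j _.
by rewrite normrM normrX (ger0_norm t0) ler_wpM2l// lerXn2r// nnegrE (le_trans t0).
Qed.

(** On the middle third of [a, b] both linear factors have modulus at least (b - a)/3; the exponent
    counts two factors, raised to the power [N] and squared. *)
Lemma bump_ge (t : R) : 2 * a + b <= 3 * t <= a + 2 * b -> a <= b ->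
  ((b - a) / 3) ^+ (4 * N) <= bump 0 t ^+ 2.
Proof.
move=> /andP[at_ tb] ab; rewrite /bump derivn0 horner_exp !hornerE -exprM (mulnC N).
rewrite !exprM lerXn2r ?nnegrE ?sqr_ge0 ?exprn_ge0 ?divr_ge0 ?subr_ge0//.
have -> : (t - a) * (t - b) = - ((t - a) * (b - t)) by ring.
rewrite sqrrN -[4%N]/(2 * 2)%N exprM lerXn2r ?nnegrE ?sqr_ge0//.
  rewrite mulr_ge0//; lra.
rewrite expr2 ler_pM ?divr_ge0 ?subr_ge0//; lra.
Qed.

End bump.

(** * Smoothing of oscillations by the scale kernel *)

Section parts.
Context {R : realType}.
Local Notation mu := (@lebesgue_measure R).
Implicit Types (F f G g : R -> R) (a b : R).

Lemma is_derive1_continuous f (t l : R) : is_derive t 1 f l -> {for t, continuous f}.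
Proof.
move=> df; apply/differentiable_continuous/derivable1_diffP.
exact: (@ex_derive _ _ _ _ _ _ _ df).
Qed.

Lemma continuous_itv_integrable f a b :
  (forall t, t \in `[a, b] -> {for t, continuous f}) ->
  mu.-integrable `[a, b] (EFin \o f).
Proof.
move=> cf; apply: continuous_compact_integrable; first exact: segment_compact.
apply/subspace_continuousP => t /= tab; apply: cvg_within_filter; exact: cf.
Qed.

Lemma Rintegral_itv_le f a b S : a <= b ->
  (forall t, t \in `[a, b] -> {for t, continuous f}) ->
  (forall t, t \in `[a, b] -> `|f t| <= S) ->
  `|\int[mu]_(t in `[a, b]) f t| <= S * (b - a).
Proof.
move=> ab cf fS.
apply: (le_trans (le_normr_Rintegral _ (continuous_itv_integrable cf))) => //.
have -> : S * (b - a) = \int[mu]_(t in `[a, b]) cst S t.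
  rewrite Rintegral_cst//= lebesgue_measure_itv/= lte_fin.
  case: ltP => // ba; have -> : a = b by apply/eqP; rewrite eq_le ab.
  by rewrite subrr.
apply: le_Rintegral => //.
  apply: continuous_itv_integrable => t tab.
  apply: continuous_comp; [exact: cf|exact: norm_continuous].
by apply: continuous_itv_integrable => t _; exact: cvg_cst.
Qed.

Lemma Rintegral_parts_eq0 F f G g a b : a < b ->
  (forall t, t \in `[a, b] -> is_derive t 1 F (f t)) ->
  (forall t, t \in `[a, b] -> is_derive t 1 G (g t)) ->
  (forall t, t \in `[a, b] -> {for t, continuous f}) ->
  (forall t, t \in `[a, b] -> {for t, continuous g}) ->
  G a = 0 -> G b = 0 ->
  \int[mu]_(t in `[a, b]) (F t * g t) = - \int[mu]_(t in `[a, b]) (f t * G t).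
Proof.
move=> ab dF dG cf cg Ga Gb.
have aab : a \in `[a, b] by rewrite in_itv/= lexx ltW.
have bab : b \in `[a, b] by rewrite in_itv/= lexx ltW.
have within_c (h : R -> R) : (forall t, t \in `[a, b] -> {for t, continuous h}) ->
    {within `[a, b], continuous h}.
  by move=> ch; apply/subspace_continuousP => t /= tab; apply: cvg_within_filter; exact: ch.
have LR (h h' : R -> R) : (forall t, t \in `[a, b] -> is_derive t 1 h (h' t)) ->
    derivable_oo_LRcontinuous h a b.
  move=> dh; split.
  - move=> t tab; apply: (@ex_derive _ _ _ _ _ _ _ (dh t _)).
    exact: subset_itv_oo_cc.
  - exact: cvg_at_right_filter (is_derive1_continuous (dh a aab)).
  - exact: cvg_at_left_filter (is_derive1_continuous (dh b bab)).
have E (h h' : R -> R) : (forall t, t \in `[a, b] -> is_derive t 1 h (h' t)) ->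
    {in `]a, b[, h^`()%classic =1 h'}.
  move=> dh t tab; rewrite derive1E; apply: (@derive_val _ _ _ _ _ _ _ (dh t _)).
  exact: subset_itv_oo_cc.
rewrite (Rintegration_by_parts ab (within_c _ cf) (LR _ _ dF) (E _ _ dF)
  (within_c _ cg) (LR _ _ dG) (E _ _ dG)).
by rewrite Ga Gb !mulr0 subrr sub0r.
Qed.

End parts.

(** * Derivatives of the kernel with respect to the scale *)

Section scale_kernel_smoothness.
Context {R : realType}.
Variables (k : nat) (g : nat -> R -> R).
Local Notation mu := (@lebesgue_measure R).
Local Notation D0 := [set x : R | 0 <= x].

Lemma has_derivative_within_is_derive (f : R -> R) (x l : R) : 0 < x ->
  has_derivative_within D0 f x l -> is_derive x 1 f l.
Proof.
move=> x0 fl.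
have H : (fun h => h^-1 *: ((f \o shift x) (h *: 1) - f x)) @ 0^' --> l.
  apply/cvgrPdist_lt => e e0; move/cvgrPdist_lt : fl => /(_ e e0).
  rewrite /within/= !near_withinE !near_simpl => -[/= d d0 Hd].
  (* A radius of at most [x] keeps [h + x] in the half-line, so the one-sided condition is void near
     [x]. *)
  exists (Num.min d x) => /=; first by rewrite lt_min d0.
  move=> h /=; rewrite sub0r normrN lt_min => /andP[hd hx] h0.
  have := Hd (h + x); rewrite /= opprD addrA addrAC subrr add0r normrN => /(_ hd).
  rewrite addrK /GRing.scale/= mulr1 mulrC; apply.
    by rewrite -subr_eq0 addrK.
  by move: hx; rewrite ltr_norml => /andP[? _]; lra.
split; first by apply/cvg_ex; exists l.
exact: cvg_lim.
Qed.

Hypothesis dg : forall (j : nat) (x : R), (j < k)%N -> 0 <= x ->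
  has_derivative_within D0 (g j) x (g j.+1 x).
Hypothesis gk_bounded : exists M : R, forall x : R, 0 <= x -> `|g k x| <= M.

Lemma is_derive_g j (x : R) : (j < k)%N -> 0 < x -> is_derive x 1 (g j) (g j.+1 x).
Proof.
by move=> jk x0; apply: has_derivative_within_is_derive => //; apply: dg => //; exact: ltW.
Qed.

(** Downward induction from order [k]: the mean value theorem between [y] and [Y] bounds each
    derivative by the next one. The point 0, where only a one-sided derivative is available, enters
    through its own value. *)
Lemma derivatives_bounded (Y : R) j : (j <= k)%N ->
  exists2 G, 0 <= G & forall y, 0 <= y <= Y -> `|g j y| <= G.
Proof.
move=> jk; rewrite -(subKn jk); elim: (k - j)%N (leq_subr j k) => [_|d IH dk].
  have [M HM] := gk_bounded; exists `|M| => // y /andP[y0 _].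
  by rewrite subn0 (le_trans (HM _ y0))// ler_norm.
have [G G0 HG] := IH (ltnW dk).
set i := (k - d.+1)%N.
have ik : (i < k)%N by rewrite /i ltn_subrL/= (leq_trans _ dk).
have iS : (k - d)%N = i.+1 by rewrite /i -subSn// subSS.
exists (`|g i 0| + `|g i Y| + G * `|Y|); first by rewrite !addr_ge0 ?mulr_ge0.
move=> y /andP[]; rewrite le_eqVlt => /predU1P[<- _|y0 yY].
  by rewrite -addrA lerDl addr_ge0// mulr_ge0.
have [z zy||c] := @MVT_segment _ (g i) (g i.+1) y Y yY.
- apply: is_derive_g => //; apply: lt_trans y0 _; by rewrite (itvP zy).
- apply/subspace_continuousP => t /=; rewrite in_itv/= => /andP[yt _].
  apply: cvg_within_filter; apply: is_derive1_continuous (is_derive_g ik _).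
  exact: lt_le_trans yt.
rewrite in_itv/= => /andP[yc cY] E.
have -> : g i y = g i Y - g i.+1 c * (Y - y) by rewrite -E; ring.
rewrite (le_trans (ler_normB _ _))// -addrA addrCA lerD//.
rewrite (le_trans _ (_ : G * `|Y| <= _))// ?lerDr// normrM ler_pM//.
  by rewrite -iS HG// (le_trans (ltW y0) yc).
rewrite ger0_norm ?subr_ge0// (le_trans _ (ler_norm _))//.
by rewrite lerBlDr lerDl ltW.
Qed.

(** When [g 0] is the density [pi1] on the half-line, [kder x 0 0 t] is pi_t(x) for x >= 0 and t >
    0. Separate indices for the power of 1/t and the derivative make the span of this family stable
    under differentiation in [t]. *)
Definition kder (x : R) (p j : nat) (t : R) : R := t^-1 ^+ p.+1 * g j (t^-1 * x).

Lemma is_derive_kder (x : R) p j (t : R) : (j < k)%N -> 0 <= x -> 0 < t ->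
  is_derive t 1 (kder x p j)
    (- p.+1%:R * kder x p.+1 j t - x * kder x p.+2 j.+1 t).
Proof.
move=> jk x0 t0.
have dV : is_derive t 1 (fun t => t^-1) (- t ^- 2).
  have D := @is_deriveV _ id t 1 1 (lt0r_neq0 t0) (is_derive_id t 1).
  by apply: (is_derive_eq D); rewrite /GRing.scale/= mulr1.
have dX := @is_deriveX _ _ _ p.+1 _ _ _ dV.
have tx : is_derive t 1 (fun t => g j (t^-1 * x)) (g j.+1 (t^-1 * x) * (- t ^- 2 * x)).
  (* At [x = 0] the function of [t] is constant, which settles the point where [g j] may lack a
     two-sided derivative. *)
  move: x0; rewrite le_eqVlt => /predU1P[<-|x0].
    rewrite !mulr0 (_ : (fun _ => _) = cst (g j 0)); first exact: is_derive_cst.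
    by apply/funext => s; rewrite mulr0.
  apply: (@is_derive1_comp _ (g j) (fun t => t^-1 * x)).
    by apply: is_derive_g => //; rewrite mulr_gt0// invr_gt0.
  have D := is_deriveM dV (is_derive_cst x t 1).
  by apply: (is_derive_eq D); rewrite scaler0 add0r /GRing.scale/= mulrC.
have D := is_deriveM dX tx.
have -> : kder x p j = (fun t => t^-1) ^+ p.+1 * (fun t => g j (t^-1 * x)).
  by apply/funext => s; rewrite mulrfctE exprfctE.
apply: (is_derive_eq D).
rewrite /kder exprfctE /GRing.scale/= -!exprVn; set s := t^-1; by rewrite !exprS; ring.
Qed.

Lemma kder_bounded (a b X : R) p j : 0 < a -> (j <= k)%N ->
  exists2 G, 0 <= G & forall x t : R, 0 <= x <= X -> t \in `[a, b] -> `|kder x p j t| <= G.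
Proof.
move=> a0 jk; have [G G0 HG] := derivatives_bounded (a^-1 * X) jk.
exists (a^-1 ^+ p.+1 * G); first by rewrite mulr_ge0// exprn_ge0// invr_ge0 ltW.
move=> x t /andP[x0 xX]; rewrite in_itv/= => /andP[at_ _].
have t0 : 0 < t by exact: lt_le_trans at_.
have ta : t^-1 <= a^-1 by rewrite lef_pV2.
have t0' : 0 <= t^-1 by rewrite invr_ge0 ltW.
rewrite /kder normrM ler_pM// ?HG ?mulr_ge0 ?ler_pM//.
by rewrite normrX ger0_norm// lerXn2r// nnegrE// (le_trans t0').
Qed.

(** Each integration by parts gains a factor 1/m, because [m * W m n.+1] is the derivative of
    [W m n]. It turns the kernel into two members of the family with [j] raised by at most one, so
    the induction on [n] is for all [p] and [j]; [j + n < k] keeps every kernel involved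
    continuous. *)
Lemma kder_oscillation (a b X : R) (W : R -> nat -> R -> R) (M : R) :
  0 < a -> a < b ->
  (forall (m : R) l (t : R), 1 <= m -> is_derive t 1 (W m l) (m * W m l.+1 t)) ->
  (forall m t : R, 1 <= m -> t \in `[a, b] -> `|W m 0%N t| <= M) ->
  (forall (m : R) l, (l < k)%N -> W m l a = 0 /\ W m l b = 0) ->
  forall n p j, (j + n < k)%N -> exists2 K, 0 <= K &
  forall x m : R, 0 <= x <= X -> 1 <= m ->
    `|\int[mu]_(t in `[a, b]) (kder x p j t * W m n t)| <= K * m^-1 ^+ n.
Proof.
move=> a0 ab dW WM Wab.
have pos (t : R) : t \in `[a, b] -> 0 < t.
  by rewrite in_itv/= => /andP[+ _]; exact: lt_le_trans.
have cW (m : R) l (t : R) : 1 <= m -> {for t, continuous (W m l)}.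
  by move=> m1; exact: is_derive1_continuous (dW m l t m1).
have ck (x : R) p j (t : R) : (j < k)%N -> 0 <= x -> t \in `[a, b] ->
    {for t, continuous (kder x p j)}.
  by move=> jk x0 /pos t0; exact: is_derive1_continuous (is_derive_kder p jk x0 t0).
have M0 : 0 <= M.
  apply: le_trans (WM 1 a (lexx 1) _) => //; by rewrite in_itv/= lexx ltW.
have ba0 : 0 <= b - a by rewrite subr_ge0 ltW.
elim=> [|n IH] p j jnk.
  rewrite addn0 in jnk; have [G G0 HG] := kder_bounded b X p a0 (ltnW jnk).
  exists (G * M * (b - a)); first by rewrite !mulr_ge0.
  move=> x m x0X m1; rewrite expr0 mulr1; apply: Rintegral_itv_le; first exact: ltW.
    move=> t tab; apply: continuousM; last exact: cW.
    by apply: ck => //; case/andP: x0X.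
  by move=> t tab; rewrite normrM ler_pM ?HG ?WM.
have [|K1 K10 HK1] := IH p.+1 j; first by rewrite (leq_trans _ jnk)// addnS ltnW.
have [|K2 K20 HK2] := IH p.+2 j.+1; first by rewrite addSnnS.
exists (p.+1%:R * K1 + `|X| * K2); first by rewrite addr_ge0// mulr_ge0.
move=> x m x0X m1; have /andP[x0 xX] := x0X.
have m0 : 0 < m by exact: lt_le_trans m1.
have jk1 : (j.+1 < k)%N by rewrite (leq_trans _ jnk)// ltnS -addn1 leq_add2l.
have jk := ltnW jk1.
have nk : (n < k)%N := leq_ltn_trans (leq_trans (leqnSn n) (leq_addl _ _)) jnk.
have [Wa Wb] := Wab m n nk.
pose f t := - p.+1%:R * kder x p.+1 j t - x * kder x p.+2 j.+1 t.
have cf t : t \in `[a, b] -> {for t, continuous f}.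
  move=> tab; apply: continuousB; apply: continuousM; try exact: cvg_cst.
    exact: ck.
  exact: ck.
have := Rintegral_parts_eq0 ab (fun t tab => is_derive_kder p jk x0 (pos t tab))
  (fun t _ => dW m n t m1) cf _ Wa Wb.
have int h : (forall t, t \in `[a, b] -> {for t, continuous h}) ->
  mu.-integrable `[a, b] (EFin \o h) := @continuous_itv_integrable _ h a b.
have mWc t : t \in `[a, b] -> {for t, continuous (fun t => m * W m n.+1 t)}.
  by move=> _; apply: continuousM; [exact: cvg_cst|exact: cW].
move=> /(_ mWc).
have -> : \int[mu]_(t in `[a, b]) (kder x p j t * (m * W m n.+1 t)) =
    m * \int[mu]_(t in `[a, b]) (kder x p j t * W m n.+1 t).
  under eq_Rintegral do rewrite mulrCA.
  rewrite RintegralZl//; apply: int => t tab; apply: continuousM; [exact: ck|exact: cW].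
have -> : \int[mu]_(t in `[a, b]) (f t * W m n t) =
    - p.+1%:R * \int[mu]_(t in `[a, b]) (kder x p.+1 j t * W m n t) -
    x * \int[mu]_(t in `[a, b]) (kder x p.+2 j.+1 t * W m n t).
  under eq_Rintegral do rewrite mulrBl -(mulrA (- p.+1%:R)) -(mulrA x).
  rewrite RintegralB//; first last.
  - apply: int => t tab; apply: continuousM; first exact: cvg_cst.
    by apply: continuousM; [exact: ck|exact: cW].
  - apply: int => t tab; apply: continuousM; first exact: cvg_cst.
    by apply: continuousM; [exact: ck|exact: cW].
  rewrite !RintegralZl//.
  - by apply: int => t tab; apply: continuousM; [exact: ck|exact: cW].
  - by apply: int => t tab; apply: continuousM; [exact: ck|exact: cW].
set I := Rintegral _ _ _; set I1 := Rintegral _ _ _; set I2 := Rintegral _ _ _ => E.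
have -> : I = m^-1 * (p.+1%:R * I1 + x * I2).
  by apply: (mulfI (lt0r_neq0 m0)); rewrite E mulrA divff ?gt_eqF// mul1r; ring.
rewrite normrM ger0_norm ?invr_ge0 ?(ltW m0)// exprS mulrCA ler_wpM2l ?invr_ge0 ?(ltW m0)//.
rewrite (le_trans (ler_normD _ _))// !normrM mulrDl -!mulrA lerD//.
  by rewrite ger0_norm// ler_wpM2l// HK1.
by apply: ler_pM => //; [rewrite (ger0_norm x0) (le_trans xX)// ler_norm|exact: HK2].
Qed.

End scale_kernel_smoothness.

(** * Lower bound on the size of the perturbation *)

Lemma L2normZ (R : realType) (a b c : R) (f : R -> R) : 0 <= c ->
  measurable_fun setT f -> L2norm a b (fun t => c * f t) = (c%:E * L2norm a b f)%E.
Proof.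
move=> c0 mf; rewrite !L2normE.
have -> : (\int[lebesgue_ab a b]_x ((c * f x) ^+ 2)%:E =
    (c ^+ 2)%:E * \int[lebesgue_ab a b]_x (f x ^+ 2)%:E)%E.
  under eq_integral do rewrite exprMn EFinM.
  rewrite ge0_integralZl//.
  - by apply/measurable_EFinP; exact: measurable_funX.
  - by move=> x _; rewrite lee_fin sqr_ge0.
  - by rewrite lee_fin sqr_ge0.
rewrite poweRM ?lee_fin ?sqr_ge0//; last first.
  by apply: integral_ge0 => x _; rewrite lee_fin sqr_ge0.
congr (_ * _)%E; rewrite poweR_EFin; congr EFin.
by rewrite -powR_mulrn// -powRrM mulfV// powRr1.
Qed.

Section oscillation_family.
Context {R : realType} (a b : R) (s N : nat) (a0 : 0 < a) (ab : a < b).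

Let u := @bump R a b N.
Let w : nat -> R -> R := fun _ _ => 0.
(** Again the zero function, in the shape that [wave_rot] expects: [wave m w' u] is the
    quarter-period shift of [wave m u w]. *)
Let w' : nat -> R -> R := fun i t => - w i t.

Let dw : deriv_seq w. Proof. by move=> i t; exact: is_derive_cst. Qed.

Let dw' : deriv_seq w'.
Proof.
move=> i t; rewrite /w' /w !oppr0.
exact: is_derive_cst.
Qed.

Let du : deriv_seq u. Proof. exact: deriv_seq_bump. Qed.

Let uw_bounded i : exists M : R, forall t, t \in `[a, b] -> `|u i t| <= M /\ `|w i t| <= M.
Proof.
have [M HM] := bump_bounded b N i a0; exists `|M| => t tab; rewrite normr0; split => //.
by rewrite (le_trans (HM t tab))// ler_norm.
Qed.

Let w'u_bounded i : exists M : R, forall t, t \in `[a, b] -> `|w' i t| <= M /\ `|u i t| <= M.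
Proof.
have [M HM] := uw_bounded i; exists M => t /HM[uM wM]; split=> //.
by rewrite /w' normrN.
Qed.

Let wave_measurable (m : R) (u1 w1 : nat -> R -> R) j :
  m != 0 -> deriv_seq u1 -> deriv_seq w1 ->
  measurable_fun setT (wave m u1 w1 j).
Proof.
move=> m0 du1 dw1; apply: continuous_measurable_fun => t.
exact: is_derive1_continuous (is_derive_wave j t m0 du1 dw1).
Qed.

(* For a large frequency, one of the two phases of the wave is bounded below in
   L2 because their squares add up to the square of the amplitude. *)
Let wave_L2_ge : exists2 c : R, 0 < c & exists m0 : R, forall m : R, 1 <= m -> m0 <= m ->
  (c%:E <= L2norm a b (wave m u w s))%E \/ (c%:E <= L2norm a b (wave m w' u s))%E.
Proof.
have [K K0 HK] := amplitudes_sqr_ge s uw_bounded.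
pose kappa := ((b - a) / 3) ^+ (4 * N).
have kappa0 : 0 < kappa by rewrite exprn_gt0// divr_gt0// subr_gt0.
(* On the middle third the two squares add up to at least [kappa / 2], so the squared norms add up
   to at least [2 * c]. *)
pose c := kappa / 2 * ((b - a) / 3) / 2.
have c0 : 0 < c by rewrite /c !divr_gt0// mulr_gt0// divr_gt0// subr_gt0.
exists (c `^ 2^-1); first by rewrite powR_gt0.
(* From this frequency on, the error [K / m] is at most [kappa / 2]. *)
exists (2 * K / kappa) => m m1 mK.
have m0 : 0 < m by exact: lt_le_trans m1.
rewrite !L2normE -poweR_EFin.
pose I1 := (\int[lebesgue_ab a b]_x (wave m u w s x ^+ 2)%:E)%E.
pose I2 := (\int[lebesgue_ab a b]_x (wave m w' u s x ^+ 2)%:E)%E.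
have I10 : (0 <= I1)%E by apply: integral_ge0 => x _; rewrite lee_fin sqr_ge0.
have I20 : (0 <= I2)%E by apply: integral_ge0 => x _; rewrite lee_fin sqr_ge0.
have mw (u1 w1 : nat -> R -> R) : deriv_seq u1 -> deriv_seq w1 ->
    measurable_fun setT (fun x : measurableTypeR R => (wave m u1 w1 s x ^+ 2)%:E).
  move=> du1 dw1; apply/measurable_EFinP; apply: measurable_funX.
  by apply: wave_measurable => //; rewrite gt_eqF.
have H : ((2 * c)%:E <= I1 + I2)%E.
  rewrite -ge0_integralD//=; first last.
  - exact: mw.
  - by move=> x _; rewrite lee_fin sqr_ge0.
  - exact: mw.
  - by move=> x _; rewrite lee_fin sqr_ge0.
  pose I := `[(2 * a + b) / 3, (a + 2 * b) / 3]%classic.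
  have mI : lebesgue_ab a b I = ((b - a) / 3)%:E.
    rewrite /lebesgue_ab /= /mrestr setIidl; last first.
      by move=> x; rewrite /I /= !in_itv/= => /andP[? ?]; apply/andP; split; lra.
    have lt_ab : (2 * a + b) / 3 < (a + 2 * b) / 3.
      by rewrite ltr_pM2r ?invr_gt0//; have := ab; lra.
    rewrite lebesgue_measure_itv/= lte_fin lt_ab.
    by rewrite -EFinB; congr EFin; field.
  have -> : (2 * c)%:E = ((kappa / 2)%:E * lebesgue_ab a b I)%E.
    by rewrite mI -EFinM; congr EFin; rewrite /c; field.
  apply: integral_ge_cst => //.
  - exact: measurable_itv.
  - by rewrite lee_fin divr_ge0// ltW.
  - by move=> x; rewrite -EFinD lee_fin addr_ge0// sqr_ge0.
  move=> x; rewrite /I /= in_itv/= => /andP[ax xb].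
  rewrite -EFinD lee_fin wave_rot; apply: le_trans (HK m x m1 _); last first.
    by rewrite /= in_itv/=; apply/andP; split; lra.
  have kx : kappa <= u 0%N x ^+ 2 by apply: bump_ge; [apply/andP; split; lra|exact: ltW].
  rewrite /w expr0n addr0.
  suff : K / m <= kappa / 2 by lra.
  rewrite ler_pdivrMr// -ler_pdivrMl ?divr_gt0//.
  by rewrite (le_trans _ mK)// le_eqVlt; apply/orP; left; apply/eqP; field; rewrite gt_eqF.
have [c1|c1] := leP c%:E I1.
  by left; apply: gt0_ler_poweR => //; rewrite in_itv/= leey andbT// lee_fin ltW.
right; apply: gt0_ler_poweR => //; first by rewrite in_itv/= leey andbT// lee_fin ltW.
  by rewrite in_itv/= leey andbT.
rewrite leNgt; apply/negP => c2; move: H; apply/negP; rewrite -ltNge.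
by rewrite mulr_natl mulr2n EFinD lteD.
Qed.

(** The phase is chosen separately for each [m], once for all levels, so that level [s] has a large
    norm; adding the bounds for both phases makes them independent of this choice. *)
Lemma oscillation_family : exists W : R -> nat -> R -> R,
  [/\ forall (m : R) l (t : R), 1 <= m -> is_derive t 1 (W m l) (m * W m l.+1 t),
      forall l, exists2 M : R, 0 <= M &
        forall m t : R, 1 <= m -> t \in `[a, b] -> `|W m l t| <= M,
      forall (m : R) l, (l < N)%N -> W m l a = 0 /\ W m l b = 0 &
      exists2 c : R, 0 < c & exists m0 : R, forall m : R, 1 <= m -> m0 <= m ->
        (c%:E <= L2norm a b (W m s))%E].
Proof.
have [c c0 [m0 H]] := wave_L2_ge.
pose ph m := `[< (c%:E <= L2norm a b (wave m u w s))%E >].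
exists (fun m => if ph m then wave m u w else wave m w' u); split.
- move=> m l t m1; have m0' : m != 0 by rewrite gt_eqF// (lt_le_trans _ m1).
  by case: ifP => _; exact: is_derive_wave.
- move=> l; have [M1 M10 HM1] := wave_bounded l uw_bounded.
  have [M2 M20 HM2] := wave_bounded l w'u_bounded.
  exists (M1 + M2); first by rewrite addr_ge0.
  move=> m t m1 tab; case: ifP => _.
    by rewrite (le_trans (HM1 m t m1 tab))// lerDl.
  by rewrite (le_trans (HM2 m t m1 tab))// lerDr.
- move=> m l lN.
  have Z t : t = a \/ t = b -> forall i, (i <= l)%N -> u i t = 0 /\ w i t = 0.
    by move=> tab i il; split => //; apply: bump_eq0 => //; exact: leq_ltn_trans il lN.
  have Za := Z a (or_introl erefl); have Zb := Z b (or_intror erefl).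
  case: ifP => _; split; apply: wave_eq0 => i il; [exact: Za|exact: Zb|..].
    by have [uz wz] := Za i il; rewrite /w' wz uz oppr0.
  by have [uz wz] := Zb i il; rewrite /w' wz uz oppr0.
- exists c => //; exists m0 => m m1 mm.
  case: ifPn => [/asboolP//|/asboolP n1].
  by have [] := H m m1 mm.
Qed.

End oscillation_family.

(** * The two hypotheses and the lower bound *)

Lemma L2_of_bounded (R : realType) (a b : R) (f : R -> R) (S : R) :
  a <= b -> 0 <= S -> measurable_fun setT f ->
  (forall t, t \in `[a, b] -> `|f t| <= S) -> exists F : L2 a b, F = f :> (R -> R).
Proof.
move=> ab S0 mf fS.
have fP : f \in Lfun (lebesgue_ab a b) 2%:E.
  apply/andP; split; rewrite inE//=.
  exact: le_lt_trans (L2norm_le ab S0 fS) (ltry _).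
by exists (Lfun_Sub (lee1n 2) fP).
Qed.

Lemma density_lawE (R : realType) (p : R -> R) (A : set R) : is_density p ->
  density_law p A = (\int[lebesgue_measure]_(x in A) (p x)%:E)%E.
Proof. by move=> pd; rewrite /density_law; case: pselect. Qed.

Section density_comparison.
Context {R : realType}.
Local Notation mu := (@lebesgue_measure R).

(** This supplies the dominating measure for [iid_law_le]: [c] times Lebesgue measure on [0, X]. *)
Lemma density_law_le (p q : R -> R) (c X : R) (c0 : 0 <= c) : is_density p -> is_density q ->
  (forall x, x \in `[0, X] -> p x <= q x + c) ->
  (forall x, x \notin `[0, X] -> p x <= q x) ->
  forall A : set (measurableTypeR R), measurable A ->
  (density_law p A <= density_law q A +
    mscale (NngNum c0) (mrestr mu (measurable_itv `[0%R, X])) A)%E.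
Proof.
move=> pd qd pq_in pq_out A mA; rewrite !density_lawE//.
have [mp p0 _] := pd; have [mq q0 _] := qd.
rewrite /mscale/= /mrestr -integral_cst/=; last exact: measurableI.
rewrite integral_mkcondr -ge0_integralD//=.
- apply: ge0_integral_mono => x Ax; rewrite lee_fin p0/= patchE.
  case: ifPn => [/[!inE]/= xX|]; first by rewrite -EFinD lee_fin pq_in.
  by rewrite notin_setE/= => /negP xX; rewrite adde0 lee_fin pq_out.
- by move=> x _; rewrite lee_fin.
- by apply/measurable_EFinP; exact: measurable_funTS.
- by move=> x _; rewrite patchE; case: ifPn => // _; rewrite lee_fin.
- apply: measurable_funTS.
  by apply/(measurable_restrictT _ (measurable_itv _)); exact: measurable_cst.
Qed.

End density_comparison.

(** The mixture is linear in the mixing density; continuity of the kernel in [t] makes both terms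
    integrable. *)
Lemma mixture_shift (R : realType) (a b : R) (pi1 : R -> R) (k : nat)
    (g : nat -> R -> R) (f0 f1 : L2 a b) (c B : R) (w : R -> R) (x : R) :
  0 < a -> (0 < k)%N ->
  (forall (j : nat) (x : R), (j < k)%N -> 0 <= x ->
     has_derivative_within [set x | 0 <= x] (g j) x (g j.+1 x)) ->
  (forall y : R, 0 <= y -> g 0%N y = pi1 y) ->
  f0 = cst c :> (R -> R) -> f1 = (fun t => c + B * w t) :> (R -> R) ->
  (forall t, {for t, continuous w}) -> 0 <= x ->
  mixture pi1 f1 x = mixture pi1 f0 x +
    B * \int[lebesgue_measure]_(t in `[a, b]) (kder g x 0 0 t * w t).
Proof.
move=> a0 k0 dg g0 f0E f1E cw x0.
have pos (t : R) : t \in `[a, b] -> 0 < t.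
  by rewrite in_itv/= => /andP[+ _]; exact: lt_le_trans.
have ck (t : R) : t \in `[a, b] -> {for t, continuous (kder g x 0 0)}.
  by move=> /pos t0; exact: is_derive1_continuous (is_derive_kder dg 0 k0 x0 t0).
have skE (t : R) : t \in `[a, b] -> scale_kernel pi1 t x = kder g x 0 0 t.
  by move=> /pos t0; rewrite /scale_kernel /kder expr1 g0// mulr_ge0// invr_ge0 ltW.
have ckw (t : R) : t \in `[a, b] -> {for t, continuous (fun t => kder g x 0 0 t * w t)}.
  by move=> tab; apply: continuousM; [exact: ck|exact: cw].
rewrite /mixture f0E f1E -RintegralZl//; last exact: continuous_itv_integrable.
transitivity (\int[lebesgue_measure]_(t in `[a, b])
    (c * kder g x 0 0 t + B * (kder g x 0 0 t * w t))).
  by apply: eq_Rintegral => t /[!inE]/= tab; rewrite skE//; ring.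
rewrite RintegralD//.
- congr (_ + _); apply: eq_Rintegral => t /[!inE]/= tab.
  by rewrite skE.
- apply: continuous_itv_integrable => t tab.
  by apply: continuousM; [exact: cvg_cst|exact: ck].
- apply: continuous_itv_integrable => t tab.
  by apply: continuousM; [exact: cvg_cst|exact: ckw].
Qed.

(** For t in [a, b] the density pi_t lives on [0, t L], which is contained in [0, b L]. *)
Lemma mixture_eq0 (R : realType) (a b : R) (pi1 : R -> R) (f : L2 a b) (x L : R) :
  0 < a -> (forall y, pi1 y != 0 -> 0 <= y <= L) ->
  x \notin `[0, b * L] -> mixture pi1 f x = 0.
Proof.
move=> a0 piL xX; rewrite /mixture (_ : Rintegral _ _ _ =
  \int[lebesgue_measure]_(t in `[a, b]) cst 0 t); last first.
  apply: eq_Rintegral => t /[!inE]/=; rewrite in_itv/= => /andP[at_ tb].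
  rewrite /scale_kernel; have [->|/piL/andP[y0 yL]] := eqVneq (pi1 (t^-1 * x)) 0.
    by rewrite !mulr0.
  have t0 : 0 < t by exact: lt_le_trans at_.
  have L0 := le_trans y0 yL.
  move: xX; rewrite in_itv/= negb_and -!ltNge => /orP[x0|xb].
    by move: y0; rewrite pmulr_rge0 ?invr_gt0// leNgt x0.
  move: yL; rewrite mulrC ler_pdivrMr// leNgt => /negP[].
  apply: le_lt_trans xb; by rewrite mulrC ler_wpM2r.
by rewrite Rintegral_cst//= mul0r.
Qed.

Theorem theorem6 (R : realType) (a b : R) (pi1 : R -> R) (k : nat)
    (C alpha : R)
    (a_gt0 : 0 < a) (a_lt_b : a < b)
    (pi1_density : is_density pi1)
    (pi1_compact_support : compact (closure [set x | pi1 x != 0]))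
    (pi1_support : closure [set x | pi1 x != 0] `<=` [set x | 0 <= x])
    (k_ge1 : (1 <= k)%N)
    (pi1_smooth : bounded_kth_derivative_within [set x | 0 <= x] k pi1)
    (C_large : (b - a) `^ (- 2^-1) < C) (alpha_ge1 : 1 <= alpha)
    (alpha_lt_k : alpha < k%:R) :
  exists2 Cstar : R, 0 < Cstar &
  exists2 eps : nat -> R, eps n @[n --> \oo] --> 0 &
  \forall n \near \oo,
    ((Cstar * n%:R `^ (- (2 * alpha / (k%:R - alpha))) * (1 + eps n))%:E <=
     minimax_risk pi1 (smooth_class a b alpha C `&` mixing_densities a b) n)%E.
Proof.
have [L piL] : exists L, forall y, pi1 y != 0 -> 0 <= y <= L.
  have [M [_ HM]] := compact_bounded pi1_compact_support.
  exists (M + 1) => y y0.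
  have cy : closure [set x | pi1 x != 0] y by exact: subset_closure.
  rewrite pi1_support//=.
  by rewrite (le_trans (ler_norm y))// (HM (M + 1))// ltrDl.
have [g [g0 dg [Mg gk]]] := pi1_smooth.
(* The number of integrations by parts: the largest one for which all kernel derivatives involved
   are continuous. *)
pose s := k.-1; have sk : s.+1 = k by rewrite /s prednK.
have [W [dW WM Wab [c0 c00 [m0 Wc0]]]] := oscillation_family s k a_gt0 a_lt_b.
have [M0 M00 HM0] := WM 0%N.
pose r := Num.truncn alpha.
have alpha_ge0 : 0 <= alpha by exact: le_trans alpha_ge1.
have alpha_r : 0 <= alpha <= r.+1%:R.
  by rewrite alpha_ge0 ltW// /r; have /andP[] := truncn_itv alpha_ge0.
have [S S0 HS] : exists2 S : R, 0 <= S & forall m t : R, 1 <= m -> t \in `[a, b] ->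
    `|W m s t| <= S /\ `|W m (s + r.+1)%N t| <= S.
  have [Ms Ms0 HMs] := WM s; have [Mr Mr0 HMr] := WM (s + r.+1)%N.
  exists (Ms + Mr) => [|m t m1 tab]; first by rewrite addr_ge0.
  split; first by rewrite (le_trans (HMs m t m1 tab))// lerDl.
  by rewrite (le_trans (HMr m t m1 tab))// lerDr.
have [K K0 HK] := kder_oscillation dg (ex_intro _ Mg gk) (b * L)
  a_gt0 a_lt_b dW HM0 Wab 0 (ltac:(by rewrite add0n -sk) : (0 + s < k)%N).
have ba0 : 0 < b - a by rewrite subr_gt0.
have C0 : 0 < C by exact: le_lt_trans (powR_ge0 _ _) C_large.
pose sba := (b - a) `^ 2^-1.
have sba0 : 0 < sba by exact: powR_gt0.
(* The constant of [omega_phi_le] without the amplitude, [m ^ alpha] and [t ^ alpha]. The amplitude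
   [beta * m ^ (- alpha)] then gives a modulus of at most [beta * T * t ^ alpha]. *)
pose T := 2 ^+ r.+1 * S * sba * (b - a) `^ alpha.
have T0 : 0 <= T by rewrite !mulr_ge0 ?exprn_ge0 ?powR_ge0.
have [beta beta0 betaT] : exists2 beta : R, 0 < beta & beta * T <= C.
  exists (C / (1 + T)); first by rewrite divr_gt0// ltr_pwDl.
  by rewrite mulrAC ler_pdivrMr ?ltr_pwDl// ler_wpM2l ?lerDr// ltW.
pose Cstar := (beta * c0) ^+ 2 / 16.
exists Cstar; first by rewrite divr_gt0// exprn_gt0// mulr_gt0.
(* For all large [n] the bound holds without an error term. *)
exists (fun=> 0); first exact: cvg_cst.
pose ka := k%:R - alpha.
have ka0 : 0 < ka by rewrite subr_gt0.
pose gap := C - (b - a) `^ (- 2^-1).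
have gap0 : 0 < gap by rewrite subr_gt0.
(* The summands ensure in turn: m >= 1, m >= m0, a nonnegative perturbed density, a norm of at most
   [C], and product laws that differ by at most 1/2. *)
pose Mbig := 1 + `|m0| + beta * S * (b - a) + beta * S * sba / gap + 2 * beta * K * `|b * L|.
have beta0' := ltW beta0; have ba0' := ltW ba0; have sba0' := ltW sba0.
have gap0' := ltW gap0.
have t1 : 0 <= beta * S * (b - a) by rewrite !mulr_ge0.
have t2 : 0 <= beta * S * sba / gap.
  by rewrite divr_ge0// !mulr_ge0.
have t3 : 0 <= 2 * beta * K * `|b * L| by rewrite !mulr_ge0.
suff main (n : nat) (m : R) : n%:R = m `^ ka -> Mbig <= m ->
    ((Cstar * m `^ (- (2 * alpha)))%:E <=
     minimax_risk pi1 (smooth_class a b alpha C `&` mixing_densities a b) n)%E.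
  have [N HN] : exists N : nat, Mbig `^ ka <= N%:R.
    exists (Num.truncn (Mbig `^ ka)).+1; rewrite ltW//.
    by have /andP[] := truncn_itv (powR_ge0 Mbig ka).
  exists N => // n /= Nn.
  have := main n (n%:R `^ ka^-1); rewrite -!powRrM mulVf ?gt_eqF// powRr1//.
  move=> /(_ erefl); rewrite addr0 mulr1.
  have -> : ka^-1 * - (2 * alpha) = - (2 * alpha / ka) by rewrite mulrN mulrC.
  apply.
  have Mbig0 : 0 < Mbig.
    by rewrite /Mbig -!addrA ltr_pwDl// !addr_ge0.
  have -> : Mbig = (Mbig `^ ka) `^ ka^-1.
    by rewrite -powRrM mulfV ?gt_eqF// powRr1// ltW.
  apply: ge0_ler_powR; [by rewrite invr_ge0 ltW|by rewrite nnegrE powR_ge0|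
    by rewrite nnegrE|].
  by rewrite (le_trans HN)// ler_nat.
move=> nm Mm.
have m1 : 1 <= m by rewrite (le_trans _ Mm)// /Mbig -!addrA lerDl !addr_ge0.
have mm0 : m0 <= m.
  rewrite (le_trans (ler_norm m0))// (le_trans _ Mm)// /Mbig.
  by have := normr_ge0 m0; lra.
have m_gt0 : 0 < m by exact: lt_le_trans m1.
have [B BE] : exists B : R, B = beta * m `^ (- alpha) by exists (beta * m `^ (- alpha)).
have B0 : 0 <= B by rewrite BE mulr_ge0 ?powR_ge0.
(* Here [alpha >= 1] enters; every smallness condition on [B] is deduced from this bound. *)
have Bm : B <= beta / m.
  rewrite BE ler_wpM2l ?(ltW beta0)// -powR_inv1 ?(ltW m_gt0)//.
  by apply: ler_powR => //; rewrite lerN2.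
pose c := (b - a)^-1.
have c_gt0 : 0 < c by rewrite invr_gt0.
have Bx x : 0 <= x -> B * x <= beta * x / m.
  by move=> x0; rewrite mulrAC ler_wpM2r.
have nm0 := normr_ge0 m0.
have BS : B * S * (b - a) <= 1.
  rewrite -mulrA (le_trans (Bx _ _)) ?mulr_ge0// ler_pdivrMr// mul1r mulrA.
  by rewrite (le_trans _ Mm)// /Mbig; lra.
have BSsba : B * S * sba <= gap.
  rewrite -mulrA (le_trans (Bx _ _)) ?mulr_ge0// ler_pdivrMr// mulrA (mulrC gap).
  by rewrite -ler_pdivrMr// (le_trans _ Mm)// /Mbig; lra.
have BK : B * (K * `|b * L|) <= 2^-1.
  rewrite (le_trans (Bx _ _)) ?mulr_ge0// ler_pdivrMr// ler_pdivlMl// !mulrA.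
  by rewrite (le_trans _ Mm)// /Mbig; lra.
(* The exponent is [(k - alpha) - (k - 1) = 1 - alpha], which is nonpositive. *)
have nms : n%:R * m^-1 ^+ s <= 1.
  rewrite exprVn -powR_mulrn ?(ltW m_gt0)// ler_pdivrMr ?powR_gt0// mul1r nm.
  by apply: ler_powR => //; rewrite /ka -sk -natr1; have := alpha_ge1; lra.
have cW : forall t : R, {for t, continuous (W m s)}.
  by move=> t; exact: is_derive1_continuous (dW m s t m1).
(* Up to the factor [m], [W m s] is the derivative of [W m s.-1], which vanishes at both ends; [s]
   is positive because [1 <= alpha < k]. The perturbation thus preserves total mass. *)
have intW : \int[lebesgue_measure]_(t in `[a, b]) W m s t = 0.
  have s_gt0 : (0 < s)%N.
    by rewrite -ltnS sk -(ltr_nat R) (le_lt_trans alpha_ge1).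
  have [|Wa Wb] := Wab m s.-1; first by rewrite prednK// -sk.
  have := @Rintegral_parts_eq0 R (cst 1) (cst 0) _ _ a b a_lt_b
    (fun t _ => is_derive_cst (1 : R) t (1 : R)) (fun t _ => dW m s.-1 t m1)
    (fun t _ => @cst_continuous _ _ 0 t) _ Wa Wb.
  rewrite prednK// => /(_ (fun t _ => continuousM (@cst_continuous _ _ (m : R) t) (cW t))).
  under eq_Rintegral do rewrite mul1r.
  rewrite RintegralZl//; last by apply: continuous_itv_integrable => t _; exact: cW.
  under [in RHS]eq_Rintegral do rewrite mul0r.
  rewrite Rintegral_cst//= mul0r oppr0 => /eqP.
  by rewrite mulf_eq0 gt_eqF//= => /eqP.
(* The unnormalised successive derivatives of [W m s], as [omega_phi_le] requires. *)
pose v j t := m ^+ j * W m (s + j)%N t.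
have dv (j : nat) (t : R) : is_derive t 1 (v j) (v j.+1 t).
  rewrite /v addnS exprSr -mulrA.
  exact: (is_deriveZ (m ^+ j) (dW m (s + j)%N t m1)).
have W_S (t : R) : t \in `[a, b] -> `|W m s t| <= S.
  by move=> tab; have [] := HS m t m1 tab.
have v0 : v 0%N = W m s by apply/funext => t; rewrite /v expr0 mul1r addn0.
have ab' := ltW a_lt_b.
have f_bound (B' t : R) : 0 <= B' <= B -> t \in `[a, b] -> `|c + B' * W m s t| <= c + B * S.
  move=> /andP[B'0 B'B] tab; rewrite (le_trans (ler_normD _ _))//.
  rewrite (ger0_norm (ltW c_gt0)) lerD2l normrM ger0_norm// ler_pM ?W_S//.
have f_ex (B' : R) : 0 <= B' <= B ->
    exists F : L2 a b, F = (fun t => c + B' * W m s t) :> (R -> R).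
  move=> B'B; apply: (@L2_of_bounded _ _ _ _ (c + B * S)) => //.
  - by rewrite addr_ge0 ?mulr_ge0// ltW.
  - apply: measurable_funD => //; apply: measurable_funM => //.
    exact: continuous_measurable_fun.
  - by move=> t; exact: f_bound.
(* A variable amplitude treats both hypotheses at once: 0 gives [F0] and [B] gives [F1]. *)
have f_class (B' : R) (F : L2 a b) : 0 <= B' <= B ->
    F = (fun t => c + B' * W m s t) :> (R -> R) ->
    (smooth_class a b alpha C `&` mixing_densities a b) F.
  move=> B'B FE; have /andP[B'0 B'B_] := B'B; split; split.
  - rewrite FE (le_trans (L2norm_le ab' _ (f_bound B' ^~ B'B)))//.
      by rewrite addr_ge0 ?mulr_ge0// ltW.
    rewrite lee_fin mulrDl -/sba.
    have -> : c * sba = (b - a) `^ (- 2^-1).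
      rewrite /c /sba -powR_inv1// -powRD; last by rewrite (gt_eqF ba0) implybT.
      by congr (_ `^ _); field.
    by rewrite -lerBrDl.
  - move=> t t0; rewrite FE -v0.
    apply: (le_trans (omega_phi_le (S := S) c a_lt_b alpha_r B'0 S0 m_gt0 t0 dv _ _)).
    + by move=> z zab; rewrite v0 W_S.
    + move=> z zab; rewrite /v normrM normrX (gtr0_norm m_gt0).
      rewrite ler_wpM2l ?exprn_ge0 ?(ltW m_gt0)//.
      by have [] := HS m z m1 zab.
    rewrite lee_fin ler_wpM2r ?powR_ge0// (le_trans _ betaT)//.
    rewrite powRM// ?(ltW m_gt0)//.
    have -> : B' * 2 ^+ r.+1 * S * sba * (m `^ alpha * (b - a) `^ alpha) =
      B' * m `^ alpha * T by rewrite /T; ring.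
    rewrite ler_wpM2r// (le_trans (ler_wpM2r _ B'B_)) ?powR_ge0//.
    by rewrite BE -mulrA -powRD ?addNr ?powRr0 ?mulr1// (gt_eqF m_gt0) implybT.
  - exists (~` `[a, b]%classic); split.
    + by apply: measurableC; exact: measurable_itv.
    + by rewrite /lebesgue_ab /= /mrestr setICl measure0.
    move=> t /= + tab; apply; rewrite FE.
    have : `|B' * W m s t| <= c.
      rewrite normrM ger0_norm// (le_trans (ler_pM _ _ B'B_ (W_S t tab)))//.
      by rewrite /c -[leRHS]mul1r ler_pdivlMr.
    by rewrite ler_norml => /andP[]; lra.
  - have iF : lebesgue_measure.-integrable `[a, b] (EFin \o F).
      apply: continuous_itv_integrable => t _; rewrite FE.
      by apply: continuousD; [exact: cvg_cst|apply: continuousM; [exact: cvg_cst|exact: cW]].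
    have -> : (\int[lebesgue_measure]_(t in `[a, b]) (F t)%:E)%E =
        (\int[lebesgue_measure]_(t in `[a, b]) F t)%:E.
      by rewrite fineK//; exact: integrable_fin_num.
    have iW : lebesgue_measure.-integrable `[a, b] (EFin \o (W m s)).
      by apply: continuous_itv_integrable => t _; exact: cW.
    rewrite FE RintegralD//; first last.
    + apply: continuous_itv_integrable => t _.
      by apply: continuousM; [exact: cvg_cst|exact: cW].
    + by apply: continuous_itv_integrable => t _; exact: cvg_cst.
    rewrite RintegralZl// intW mulr0 addr0 Rintegral_cst//=.
    rewrite lebesgue_measure_itv/= lte_fin a_lt_b.
    by rewrite -EFinB/= mulVf// gt_eqF.
have [F0 F0E] := f_ex 0 (ltac:(by rewrite lexx)).
have [F1 F1E] := f_ex B (ltac:(by rewrite lexx andbT)).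
have F0_class := f_class 0 F0 (ltac:(by rewrite lexx)) F0E.
have F1_class := f_class B F1 (ltac:(by rewrite lexx andbT)) F1E.
have F0E' : F0 = cst c :> (R -> R) by rewrite F0E; apply/funext => t; rewrite mul0r addr0.
have -> : Cstar * m `^ (- (2 * alpha)) = (B * c0) ^+ 2 / 16.
  rewrite /Cstar BE -mulrN (mulrC 2) powRrM powR_mulrn ?powR_ge0//.
  by field.
apply: (@two_point_risk R a b pi1 _ n F0 F1 (B * c0)) => //.
- by rewrite mulr_ge0// ltW.
- rewrite /L2dist (_ : (fun _ => _) = (fun t => B * W m s t)); last first.
    by apply/funext => t; rewrite F0E' F1E addrAC subrr add0r.
  rewrite L2normZ//; last exact: continuous_measurable_fun.
  by rewrite EFinM lee_wpmul2l ?lee_fin// Wc0.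
pose delta := B * (K * m^-1 ^+ s).
have delta0 : 0 <= delta by rewrite !mulr_ge0// exprn_ge0// invr_ge0 ltW.
have d0 := mixture_is_density a_gt0 pi1_density F0_class.2.
have d1 := mixture_is_density a_gt0 pi1_density F1_class.2.
have mix (x : R) : x \in `[0, b * L] -> mixture pi1 F1 x <= mixture pi1 F0 x + delta.
  rewrite in_itv/= => x0L; have /andP[x0 xL] := x0L.
  rewrite (mixture_shift a_gt0 k_ge1 dg g0 F0E' F1E cW x0) lerD2l ler_wpM2l//.
  exact: le_trans (ler_norm _) (HK x m x0L m1).
have mix_out (x : R) : x \notin `[0, b * L] -> mixture pi1 F1 x <= mixture pi1 F0 x.
  by move=> xL; rewrite !(mixture_eq0 _ a_gt0 piL xL).
move=> A mA.
have := iid_law_le (density_law_le delta0 d1 d0 mix mix_out).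
(* The absolute value covers the case [b * L <= 0], where the interval is a null set. *)
move=> /(_ (delta * `|b * L|) n A _ mA) H; apply: (le_trans (H _)).
  rewrite /= /mscale/= /mrestr setTI lebesgue_measure_itv/= lte_fin.
  case: ifP => bL; last by rewrite mule0 lee_fin mulr_ge0.
  by rewrite -EFinB -EFinM subr0 lee_fin ler_wpM2l// ler_norm.
rewrite leeD2l// lee_fin.
(* The first factor is at most 1 by [nms], the second at most 1/2 by [BK]. *)
have -> : n%:R * (delta * `|b * L|) = n%:R * m^-1 ^+ s * (B * (K * `|b * L|)).
  by rewrite /delta; ring.
rewrite -[leRHS]mul1r; apply: ler_pM => //.
  by rewrite mulr_ge0// exprn_ge0// invr_ge0 ltW.
by rewrite !mulr_ge0.
Qed.
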